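(* There is a universal constant $\alpha\in\mathbb{N}$ and a deterministic algorithm $\mathcal{A}$ such that the following holds. Given a graph $G$ with $m$ edges, a length parameter $L\in\mathbb{N}$ and a fault parameter $f\in\mathbb{N}$, the algorithm $\mathcal{A}$ computes an $(L,f)$-replacement path covering $\mathcal{G}_{L,f}$ of $G$ such that, writing $a=\max\{L,f\}$ and $b=\min\{L,f\}$, \[ \mathsf{CV}(\mathcal{G}_{L,f})\le \begin{cases} (\alpha c Lf)^{b+1}, & \text{if } a\ge m^{1/c} \text{ for some constant } c\in\mathbb{N},\\ (\alpha Lf)^{b+2}\cdot \log m, & \text{if } a=m^{o(1)} \text{ and } b=\Omega(\log m),\\ (\alpha Lf)^{b+2}\cdot \log m, & \text{if } a\le \log m,\\ (\alpha Lf\log m)^{b+1}, & \text{otherwise.} \end{cases} \] Moreover, the running time of $\mathcal{A}$ is $m^{1+o(1)}\cdot \mathsf{CV}(\mathcal{G}_{L,f})$ if $a=m^{o(1)}$ and $b=\Omega(\log m)$, and $m\cdot(\log m)^{O(1)}\cdot \mathsf{CV}(\mathcal{G}_{L,f})$ otherwise.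
   Context: $G=(V,E)$ is a (possibly weighted) graph. For $s,t\in V$ and $F\subseteq E$, a replacement path $P(s,t,F)$ is a shortest $s$-$t$ path in $G\setminus F$. A subgraph $G'\subseteq G$ covers $P(s,t,F)$ if $P(s,t,F)\subseteq G'$ and $F\cap E(G')=\emptyset$. A collection $\mathcal{G}_{L,f}$ of subgraphs of $G$ is an $(L,f)$-replacement path covering ($(L,f)$-RPC) if for every $s,t\in V$ and every $F\subseteq E$ with $|F|\le f$, each replacement path $P(s,t,F)$ with at most $L$ edges is covered by some subgraph in $\mathcal{G}_{L,f}$ (if there are several $s$-$t$ shortest paths in $G\setminus F$ with at most $L$ edges, it suffices to cover one of them). The covering value is $\mathsf{CV}(\mathcal{G}_{L,f})=|\mathcal{G}_{L,f}|$. *)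

(* Defs.v *)
From HB Require Import structures.
From mathcomp Require Import all_boot all_order all_algebra.

Set Implicit Arguments.
Unset Strict Implicit.
Unset Printing Implicit Defensive.

(* A simple undirected graph on the vertex set 'I_nv whose m edges are listed
   without repetition; the unweighted case is wt = fun=> 1.  Weights are
   rational so that they can be part of the input of an algorithm. *)
Record wgraph (m : nat) := WGraph {
  nv : nat;
  ends : 'I_m -> {set 'I_nv};
  wt : 'I_m -> rat;
  card_ends : forall e, #|ends e| = 2;
  ends_inj : injective ends
}.

Section Covering.
Variables (m : nat) (G : wgraph m).
Implicit Types (s t v : 'I_(nv G)) (F H : {set 'I_m}).

(* A walk from s is the list of its steps (edge used, vertex reached). *)
Fixpoint is_walk s (p : seq ('I_m * 'I_(nv G))) : bool :=
  if p is (e, v) :: p' then (ends G e == [set s; v]) && is_walk v p' else true.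

Definition is_path F s t (p : seq ('I_m * 'I_(nv G))) : bool :=
  [&& is_walk s p, last s (unzip2 p) == t, uniq (s :: unzip2 p)
    & all (fun e => e \notin F) (unzip1 p)].

Definition weight (p : seq ('I_m * 'I_(nv G))) : rat :=
  (\sum_(x <- p) wt G x.1)%R.

Definition replacement_path s t F (p : seq ('I_m * 'I_(nv G))) : Prop :=
  is_path F s t p /\
  forall p', is_path F s t p' -> (weight p <= weight p')%R.

(* A subgraph of G is given by its edge set H (it keeps all vertices). *)
Definition covers H F (p : seq ('I_m * 'I_(nv G))) : bool :=
  all (fun e => e \in H) (unzip1 p) && [disjoint F & H].

(* A collection of subgraphs is a list of edge sets; CV is its length. *)
Definition CV (C : seq {set 'I_m}) : nat := size C.

Definition is_RPC (L f : nat) (C : seq {set 'I_m}) : Prop :=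
  forall s t F, #|F| <= f ->
    (exists2 p, replacement_path s t F p & size p <= L) ->
    exists p, [/\ replacement_path s t F p, size p <= L
                & exists2 H, H \in C & covers H F p].

End Covering.

(* Word RAM model.

   Programs are while-programs over registers and a random access memory, both
   holding natural numbers below the word bound W, and a write-only output
   stream.  Each step costs 1.  A step that would produce a value >= W is
   undefined, so a run that halts never exceeds the word size. *)

Inductive binop := Add | Sub | Mul | Div | Mod | Ltn | Eqn.

Inductive cmd :=
  | Skip
  | Const of nat & nat              (* r := k *)
  | Op of binop & nat & nat & nat   (* r := x o y *)
  | Read of nat & nat               (* r := mem[x] *)
  | Write of nat & nat              (* mem[x] := y *)
  | Emit of nat                     (* append x to the output *)
  | Seq of cmd & cmd
  | If of nat & cmd & cmd           (* if x != 0 then _ else _ *)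
  | While of nat & cmd.             (* while x != 0 do _ *)

Definition eval_op (o : binop) (x y : nat) : nat :=
  match o with
  | Add => x + y
  | Sub => x - y
  | Mul => x * y
  | Div => x %/ y
  | Mod => x %% y
  | Ltn => nat_of_bool (x < y)
  | Eqn => nat_of_bool (x == y)
  end.

Record state := State {
  reg : nat -> nat;
  mem : nat -> nat;
  out : seq nat   (* in order of emission *)
}.

Definition set_reg (W : nat) (r v : nat) (st : state) : option state :=
  if v < W then Some (State [eta reg st with r |-> v] (mem st) (out st))
  else None.

(* The commands still to be executed, and the current state. *)
Definition config := (seq cmd * state)%type.

Definition step (W : nat) (c : config) : option config :=
  let: (k, st) := c in
  match k with
  | [::] => None
  | i :: k =>
    match i with
    | Skip => Some (k, st)
    | Const r n => omap (pair k) (set_reg W r n st)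
    | Op o r x y =>
        omap (pair k) (set_reg W r (eval_op o (reg st x) (reg st y)) st)
    | Read r x => omap (pair k) (set_reg W r (mem st (reg st x)) st)
    | Write x y =>
        Some (k, State (reg st) [eta mem st with reg st x |-> reg st y] (out st))
    | Emit x => Some (k, State (reg st) (mem st) (rcons (out st) (reg st x)))
    | Seq i1 i2 => Some (i1 :: i2 :: k, st)
    | If x i1 i2 => Some ((if reg st x != 0 then i1 else i2) :: k, st)
    | While x i1 =>
        Some (if reg st x != 0 then i1 :: While x i1 :: k else k, st)
    end
  end.

Definition steps (W T : nat) (c : config) : option config :=
  iter T (obind (step W)) (Some c).

Definition init_state (inp : seq nat) : state :=
  State (fun=> 0) (nth 0 inp) [::].

(* Program A halts on inp after exactly T steps with output o. *)
Definition halts (W : nat) (A : cmd) (inp : seq nat) (T : nat) (o : seq nat)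
    : Prop :=
  exists2 st, steps W T ([:: A], init_state inp) = Some ([::], st)
            & out st = o.

(* Words have kappa * log N bits, where N bounds the length of the input and
   every number in it. *)
Definition word_bound (kappa : nat) (inp : seq nat) : nat :=
  ((size inp + \max_(x <- inp) x).+2) ^ kappa.

(* Endpoints, then sign, numerator and denominator of the weight. *)
Definition encode_edge (m : nat) (G : wgraph m) (e : 'I_m) : seq nat :=
  map val (enum (ends G e)) ++
  [:: nat_of_bool (numq (wt G e) < 0)%R;
      absz (numq (wt G e)); absz (denq (wt G e))].

Definition encode_input (m : nat) (G : wgraph m) (L f : nat) : seq nat :=
  [:: nv G; m; L; f] ++ flatten [seq encode_edge G e | e <- enum 'I_m].

(* Indicator vector of the edge set, followed by the terminator 2. *)
Definition encode_subgraph (m : nat) (H : {set 'I_m}) : seq nat :=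
  rcons [seq nat_of_bool (e \in H) | e <- enum 'I_m] 2.

Definition encode_collection (m : nat) (C : seq {set 'I_m}) : seq nat :=
  flatten [seq encode_subgraph H | H <- C].

Record algorithm := Algorithm { code : cmd; wordsize : nat }.

Definition computes (A : algorithm) (m : nat) (G : wgraph m) (L f T : nat)
    (C : seq {set 'I_m}) : Prop :=
  let inp := encode_input G L f in
  halts (word_bound (wordsize A) inp) (code A) inp T (encode_collection C).

(* The model is deterministic: running time and result are determined by the
   instance. *)

Lemma steps_none (W T : nat) : iter T (obind (step W)) None = None.
Proof. by elim: T => //= T ->. Qed.

Lemma steps_halted (W T : nat) (c : config) (st st' : state) d :
  steps W T c = Some ([::], st) -> steps W (d + T) c = Some ([::], st') ->
  d = 0.
Proof.
rewrite /steps iterD => ->; case: d => // d.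
by rewrite iterSr /= steps_none.
Qed.

Lemma halts_inj W A inp T1 T2 o1 o2 :
  halts W A inp T1 o1 -> halts W A inp T2 o2 -> T1 = T2 /\ o1 = o2.
Proof.
move=> [s1 h1 <-] [s2 h2 <-].
have eT : T1 = T2.
  case: (leqP T1 T2) => le12.
    have := h2; rewrite -(subnK le12) => /(steps_halted h1) d0.
    by rewrite d0.
  have := h1; rewrite -(subnK (ltnW le12)) => /(steps_halted h2) d0.
  by rewrite d0.
by subst T2; split=> //; move: h2; rewrite h1 => -[->].
Qed.

Lemma encode_collection_inj m : injective (@encode_collection m).
Proof.
rewrite /encode_collection; elim=> [|H C IH] [|H' C'] //=.
- by rewrite /encode_subgraph; case: [seq _ | _ <- _].
- by rewrite /encode_subgraph; case: [seq _ | _ <- _].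
move/eqP; rewrite eqseq_cat; last by rewrite !size_rcons !size_map.
case/andP=> /eqP eH /eqP /IH ->; congr cons.
move: eH => /rcons_inj [eH]; apply/setP => e.
have /eq_in_map/(_ e) := eH; rewrite mem_enum => /(_ isT).
by case: (e \in H); case: (e \in H').
Qed.

Lemma computes_inj A m (G : wgraph m) L f T1 T2 C1 C2 :
  computes A G L f T1 C1 -> computes A G L f T2 C2 -> T1 = T2 /\ C1 = C2.
Proof.
by move=> h1 h2; have [-> /encode_collection_inj] := halts_inj h1 h2.
Qed.

From mathcomp Require Import all_classical all_reals all_analysis.
Import Order.TTheory GRing.Theory Num.Theory numFieldNormedType.Exports.
Local Open Scope classical_set_scope.
Local Open Scope ring_scope.

Definition log2 {R : realType} (m : nat) : R := ln m%:R / ln 2.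

Section Regimes.
Variables (R : realType).
(* The parameters L and f as functions of the number m of edges. *)
Variables (L f : nat -> nat).

Let a m : R := (maxn (L m) (f m))%:R.
Let b m : R := (minn (L m) (f m))%:R.

(* a >= m^(1/c) for some constant c *)
Definition polynomial_regime : Prop :=
  exists2 c : nat, (0 < c)%N &
    \forall m \near \oo, m%:R `^ c%:R^-1 <= a m.

(* a = m^o(1) and b = Omega(log m) *)
Definition subpolynomial_regime : Prop :=
  (exists2 eps : nat -> R, eps @ \oo --> (0 : R) &
     \forall m \near \oo, a m = m%:R `^ eps m) /\
  (b : nat -> R^o) \is 'Omega_\oo(@log2 R : nat -> R^o).

End Regimes.

(* Main.v *)
(* Colour the edges by a family of hash functions [h] into [q] colours such
   that any disjoint [P], [F] with [|P| <= L], [|F| <= f] are separated by some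
   [h]; if [b = min L f], guessing the at most [b] colours of the smaller of the
   two sets then gives [q ^ b] subgraphs per [h].  Separation follows when two
   distinct edges collide under less than a fraction [1 / (L f)] of the family.

   The edges are first hashed by a Reed-Solomon code: with [k] least such that
   [m <= (2 k L f) ^ k] and a prime [p = Theta (k L f)], polynomials of degree
   less than [k] over 'F_p collide at fewer than [k] of the [p] points.  This
   alone gives [p ^ b.+1] subgraphs.  Alternatively, the alphabet is reduced to
   [q = 8 L f] by [q log p] functions found greedily with multiplicative weights
   (a derandomized Gilbert-Varshamov bound), at the cost of a factor
   [L f log p].  The second option is taken when [L f log p <= k ^ b]; either
   way the number of subgraphs is at most [O(k L f) ^ b.+1], where [k <= c] as
   soon as [m <= a ^ c], and at most [O(L f) ^ b.+2 * log m], because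
   [k log p = O(log m)].  Both bounds hold in all regimes, and so does the
   running time [O(m k)] per subgraph: computing the tables costs no more. *)
Require Import Defs.
From HB Require Import structures.
From mathcomp Require Import all_boot all_order all_algebra.
From mathcomp Require Import all_classical all_reals all_analysis.
From mathcomp Require Import zify lra.
Import Order.TTheory GRing.Theory Num.Theory numFieldNormedType.Exports.

Set Implicit Arguments.
Unset Strict Implicit.
Unset Printing Implicit Defensive.

(** The collection is a function of [m], [L] and [f] alone: what gets separated is a set of at most
    [L] edge numbers from a disjoint set of at most [f]. Both parameters are first cut down to
    [m + 1], harmless because no edge set exceeds [m] elements; from then on every number is at most
    a fixed power of [m + 2], so the program runs in the prescribed words.

    The constants come from sharing the error. A union bound over [L f] pairs tolerates a collision
    rate below [1 / (L f)]. Reed-Solomon receives half of it, whence [p >= 2 k L f]. Doubling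
    weights leave at most [4 log p] collisions among [q log p] functions, a rate [4 / q], which is
    the other half for [q = 8 L f].

    The prime is found by searching upwards from [2 k L f], so an explicit bound on the least prime
    is required; its factor ends up in [alpha]. Running time is a number of machine steps, so the
    program is written in a small language whose compilation is proved correct with exact costs. *)

(** * A prime between [n] and [4 ^ 6 * n] *)

Lemma logn_central p n :
  prime p ->
  logn p 'C(n.*2, n) + (logn p n`!).*2 = logn p (n.*2)`!.
Proof.
move=> pp; have le_n : n <= n.*2 by rewrite -addnn leq_addl.
rewrite -(bin_fact le_n) -addnn addnK !lognM ?muln_gt0 ?fact_gt0 ?addnn //.
by rewrite bin_gt0.
Qed.

Lemma logn_fact_eq0 p n : prime p -> n < p -> logn p n`! = 0.
Proof.
move=> pp ltnp; rewrite logn_fact // big_nat big1 // => k /andP[k0 _].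
rewrite divn_small //; apply: leq_trans ltnp _.
by rewrite -{1}(expn1 p) leq_pexp2l ?(prime_gt0 pp).
Qed.

Lemma logn_central_eq0 p n : n.*2 < p -> logn p 'C(n.*2, n) = 0.
Proof.
move=> ltnp; case pp: (prime p); last by rewrite lognE pp.
by have := logn_central n pp; rewrite (logn_fact_eq0 pp ltnp); lia.
Qed.

Lemma logn_central_gt0 p n :
  prime p -> n < p <= n.*2 -> 0 < logn p 'C(n.*2, n).
Proof.
move=> pp /andP[lt_np le_p2n]; have := logn_central n pp.
rewrite (logn_fact_eq0 pp lt_np) /= addn0 => ->.
rewrite logn_gt0 mem_primes pp fact_gt0 /=.
by apply: dvdn_fact; rewrite prime_gt0.
Qed.

(* Kummer: the k-th term of Legendre's formula contributes at most one, and
   nothing once [p ^ k > 2 n]. *)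
Lemma logn_central_le p n : prime p -> logn p 'C(n.*2, n) <= trunc_log p n.*2.
Proof.
move=> pp; have := logn_central n pp; have p1 := prime_gt1 pp.
set t := trunc_log _ _.
have lF m : m <= n.*2 -> logn p m`! = \sum_(1 <= k < n.*2.+1) m %/ p ^ k.
  move=> le_m; rewrite logn_fact // [in RHS](@big_cat_nat _ _ _ m.+1) //=.
  rewrite [X in _ = _ + X]big_nat [X in _ = _ + X]big1 ?addn0 //.
  move=> k /andP[lt_mk _].
  by rewrite divn_small // (leq_trans lt_mk) // ltnW // ltn_expl.
rewrite !lF //; last by rewrite -addnn leq_addl.
rewrite -[X in _ + X = _]muln2 big_distrl /=.
move=> E; apply: (@leq_trans (\sum_(1 <= k < n.*2.+1) (k <= t))); last first.
  rewrite (eq_bigr (fun k => if k <= t then 1 else 0)); last first.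
    by move=> k _; case: leqP.
  rewrite -big_mkcond /= sum1_count -size_filter.
  apply: leq_trans (_ : size (index_iota 1 t.+1) <= t); last first.
    by rewrite size_iota subn1.
  apply: uniq_leq_size; first by rewrite filter_uniq ?iota_uniq.
  by move=> i; rewrite !mem_filter !mem_index_iota; lia.
rewrite -(leq_add2r (\sum_(1 <= k < n.*2.+1) n %/ p ^ k * 2)) E -big_split /=.
apply: leq_sum => k _; case: (leqP k t) => [_|lt_tk].
  have p_gt0 : 0 < p ^ k by rewrite expn_gt0 prime_gt0.
  have := divn_eq n (p ^ k); have := ltn_pmod n p_gt0.
  move: (n %/ _) (n %% _) => u v lt_v ->.
  have -> : (u * p ^ k + v).*2 = u * 2 * p ^ k + v.*2 by nia.
  by rewrite divnMDl // addnC leq_add2r -ltnS ltn_divLR //; lia.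
rewrite divn_small //; apply: leq_trans (trunc_log_ltn n.*2 p1) _.
by rewrite leq_pexp2l ?(prime_gt0 pp).
Qed.

Lemma central_decomp n :
  'C(n.*2, n) = \prod_(0 <= p < n.*2.+1) p ^ logn p 'C(n.*2, n).
Proof.
have C0 : 0 < 'C(n.*2, n) by rewrite bin_gt0 -addnn leq_addl.
rewrite -{1}[LHS](partnT C0) (widen_partn _ (leq_maxl _ n.*2)).
rewrite (@big_cat_nat _ _ _ n.*2.+1) //= ?ltnS ?leq_maxr //.
rewrite [X in _ * X]big_nat_cond [X in _ * X]big1 ?muln1 //.
by move=> p /andP[/andP[lt_p _] _]; rewrite logn_central_eq0.
Qed.

Lemma central_le n : 'C(n.*2, n) <= 4 ^ n.
Proof.
have -> : 4 ^ n = 2 ^ n.*2 by rewrite -muln2 mulnC expnM.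
have -> : 2 ^ n.*2 = \sum_(i < n.*2.+1) 'C(n.*2, i).
  rewrite -(addn1 1) expnDn; apply: eq_bigr => i _.
  by rewrite !exp1n !muln1.
have lt_n : n < n.*2.+1 by rewrite ltnS -addnn leq_addl.
by rewrite (bigD1 (Ordinal lt_n)) //= leq_addr.
Qed.

(** Pascal's rule writes the next coefficient as two equal terms, each at least the present one. The
    base 2 instead of nearly 4 is compensated by the generous ratio [4 ^ 5] in
    [prime_between_pow4]. *)
Lemma central_ge n : 2 ^ n <= 'C(n.*2, n).
Proof.
elim: n => // n IHn; rewrite doubleS binS expnS mul2n -addnn.
have -> : 'C(n.*2.+1, n.+1) = 'C(n.*2.+1, n).
  rewrite -bin_sub; first by rewrite -addnn subSS addnK.
  by rewrite ltnS -addnn leq_addl.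
by apply: leq_add; apply: leq_trans IHn _; apply: leq_bin2l.
Qed.

(** Erdős' bound on primorials: every prime in [(n, 2n]] divides ['C(2n, n) <= 4 ^ n]. Along powers
    of two the induction is pure doubling, [4 ^ n * 4 ^ n = 4 ^ (2n)]. *)
Lemma prod_primes_le j :
  \prod_(0 <= p < (2 ^ j).+1 | prime p) p <= 4 ^ (2 ^ j).
Proof.
elim: j => [|j IHj]; first by rewrite unlock.
set n := 2 ^ j in IHj *; have -> : 2 ^ j.+1 = n.*2 by rewrite expnS mul2n.
rewrite (@big_cat_nat _ _ _ n.+1) //=; last by rewrite ltnS -addnn leq_addl.
rewrite -addnn expnD; apply: leq_mul => //; rewrite addnn.
apply: leq_trans (central_le n).
rewrite central_decomp (@big_cat_nat _ _ _ n.+1 0 n.*2.+1) //=; last first.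
  by rewrite ltnS -addnn leq_addl.
rewrite -[X in X <= _]mul1n; apply: leq_mul.
  by apply: prodn_gt0 => p; exact: pfactor_gt0.
rewrite big_mkcond big_nat [leqRHS]big_nat; apply: leq_prod => p le_p.
case: ifP => [pp|_]; last by case: p le_p => [|p]; rewrite ?expn_gt0.
rewrite -{1}(expn1 p) leq_pexp2l ?(prime_gt0 pp) // logn_central_gt0 //; lia.
Qed.

Lemma pow4 k : 4 ^ k = 2 ^ (2 * k).
Proof. by rewrite expnM. Qed.

(** Chebyshev's argument with [2n = 4 ^ (i + 5)]: without a prime in the interval, ['C(2n, n)] has
    only prime factors up to [4 ^ i], too few to reach [2 ^ n]. *)
Lemma prime_between_pow4 i : exists2 p, prime p & 4 ^ i < p <= 4 ^ (i + 5).
Proof.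
pose n := 2 ^ (2 * i + 9).
have En : n.*2 = 4 ^ (i + 5).
  by rewrite /n -mul2n -expnS (_ : 4 = 2 ^ 2) // -expnM; congr (2 ^ _); lia.
case: (boolP (has (fun p => prime p && (4 ^ i < p)) (iota 0 n.*2.+1))).
  case/hasP => p; rewrite mem_iota add0n ltnS En => /andP[_ le_p] /andP[pp lt_p].
  by exists p; rewrite // lt_p.
move=> /hasPn noP; exfalso.
have small : 'C(n.*2, n) <= n.*2 ^ (2 ^ (i + 5)) * 4 ^ (2 ^ (2 * i)).
  rewrite central_decomp.
  have ES : 2 ^ (i + 5) <= n.*2.
    by rewrite En pow4 leq_exp2l //; lia.
  (* A prime up to [2 ^ (i + 5)], the square root of [2n], contributes at most [2n]; a larger one
     has exponent at most one and is at most [4 ^ i] by assumption. Index 0 gets the factor 1, which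
     leaves exactly [2 ^ (i + 5)] factors [2n]. *)
  have step p : p < n.*2.+1 -> p ^ logn p 'C(n.*2, n) <=
      (if p < (2 ^ (i + 5)).+1 then (if p == 0 then 1 else n.*2) else 1) *
      (if (p < (2 ^ (2 * i)).+1) && prime p then p else 1).
    move=> lt_p; case pp: (prime p); last first.
      rewrite lognE pp /= expn0 andbF muln1; case: ifP => // _.
      by case: ifP => // _; rewrite /n double_gt0 expn_gt0.
    have p_gt0 := prime_gt0 pp; rewrite andbT (gtn_eqF p_gt0).
    have p_le : p ^ logn p 'C(n.*2, n) <= n.*2.
      apply: leq_trans (trunc_logP (prime_gt1 pp) _); last first.
        by rewrite /n double_gt0 expn_gt0.
      by rewrite leq_pexp2l // logn_central_le.
    case: ifP => [_|/negbT ltSp].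
      by case: ifP => _; rewrite ?muln1 // (leq_trans p_le) // leq_pmulr.
    rewrite mul1n.
    have -> : p < (2 ^ (2 * i)).+1.
      rewrite ltnS expnM; have := noP p; rewrite mem_iota add0n lt_p => /(_ isT).
      by rewrite pp /= -leqNgt.
    rewrite -[leqRHS]expn1 leq_pexp2l //.
    apply: leq_trans (logn_central_le n pp) _.
    rewrite -ltnS -(ltn_exp2l _ _ (prime_gt1 pp)).
    apply: leq_ltn_trans (trunc_logP (prime_gt1 pp) _) _.
      by rewrite /n double_gt0 expn_gt0.
    rewrite En pow4 mulnC expnM ltn_exp2r //.
    by move: ltSp; rewrite ltnS -ltnNge.
  apply: (@leq_trans (\prod_(0 <= p < n.*2.+1) _)).
    rewrite big_nat [leqRHS]big_nat; apply: leq_prod => p /andP[_ lt_p].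
    exact: step lt_p.
  rewrite big_split /=; apply: leq_mul.
    rewrite -big_mkcond -(@big_nat_widen _ _ _ _ (2 ^ (i + 5)).+1 _ xpredT) //.
    rewrite big_ltn //= mul1n.
    rewrite (@eq_big_nat _ _ _ _ _ _ (fun=> n.*2)); last by case.
    by rewrite prod_nat_const_nat subn1.
  have -> : \prod_(0 <= p < n.*2.+1)
      (if (p < (2 ^ (2 * i)).+1) && prime p then p else 1) =
      \prod_(0 <= p < (2 ^ (2 * i)).+1 | prime p) p.
    rewrite -big_mkcond [RHS](@big_nat_widen _ _ _ _ _ n.*2.+1) /=.
      by apply: eq_bigl => p; rewrite andbC.
    by rewrite En pow4 ltnS leq_exp2l //; lia.
  exact: prod_primes_le.
have := leq_trans (central_ge n) small.
rewrite En !pow4 -expnM -expnD leq_exp2l // /n.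
move=> H.
(* With [u = 2 ^ i > i] the left side is [64 (i + 5) u + 2 u ^ 2 <= 322 u ^ 2], the right side
   [512 u ^ 2]. *)
suff: (2 * (i + 5)) * 2 ^ (i + 5) + 2 * 2 ^ (2 * i) < 2 ^ (2 * i + 9) by lia.
have -> : 2 ^ (2 * i + 9) = 512 * (2 ^ i * 2 ^ i).
  by rewrite mul2n -addnn !expnD mulnC.
have -> : 2 ^ (2 * i) = 2 ^ i * 2 ^ i by rewrite mul2n -addnn expnD.
have -> : 2 ^ (i + 5) = 32 * 2 ^ i by rewrite expnD mulnC.
have := ltn_expl i (isT : 1 < 2).
move: (2 ^ i) => u lt_i; nia.
Qed.

(* The pieces [4 ^ i, 4 ^ i.+1] are too short for the previous lemma; five of
   them cost a factor [4 ^ 5], the rounding of [n] to a power of 4 another 4. *)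
Lemma prime_between n : 0 < n -> exists2 p, prime p & n <= p <= 4 ^ 6 * n.
Proof.
move=> n0; have [p pp /andP[lt_p le_p]] := prime_between_pow4 (up_log 4 n).
exists p => //; apply/andP; split.
  by apply: leq_trans (ltnW lt_p); apply: up_logP.
apply: leq_trans le_p _; case: (ltnP 1 n) => [n1|le_n1]; last first.
  have -> : n = 1 by lia.
  by rewrite up_log1.
have := up_log_gtn (isT : 1 < 4) n1; have := up_log_gt0 4 n; rewrite n1 /=.
case: (up_log 4 n) => // k _ /= lt_k.
have -> : k.+1 + 5 = 6 + k by lia.
by rewrite expnD; apply: leq_mul => //; apply: ltnW.
Qed.

(** * Greedy hash tables *)

(** Ties go to the smallest index, exactly as in the loop of [find_lightest], so that program and
    specification produce the same table. *)
Fixpoint argmin_nat (s : nat -> nat) (n : nat) : nat :=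
  if n is n'.+1 then
    if s n' < s (argmin_nat s n') then n' else argmin_nat s n'
  else 0.

Lemma argmin_nat_lt s n : 0 < n -> argmin_nat s n < n.
Proof.
case: n => // n _; elim: n => [|n IHn] /=; first by case: ifP.
by case: ifP => _; rewrite ?leqnn // ltnW.
Qed.

Lemma argmin_nat_min s n v : v < n -> s (argmin_nat s n) <= s v.
Proof.
elim: n v => // n IHn v; rewrite ltnS leq_eqVlt => /predU1P[->|/IHn] /=.
  by case: ltnP.
by case: ltnP => // /ltnW lt_s /(leq_trans lt_s).
Qed.

Section Greedy.
Variables (w : nat -> nat -> nat) (q : nat).

(** The choice at [x] depends on all earlier choices, so a whole row is built; [greedyE] restores
    the intended recursion. *)
Fixpoint greedy_row (n : nat) : seq nat :=
  if n is x.+1 then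
    let r := greedy_row x in
    rcons r (argmin_nat (fun v => \sum_(0 <= y < x | nth 0 r y == v) w x y) q)
  else [::].

Definition greedy (x : nat) : nat := nth 0 (greedy_row x.+1) x.

Lemma size_greedy_row n : size (greedy_row n) = n.
Proof. by elim: n => //= n IHn; rewrite size_rcons IHn. Qed.

Lemma nth_greedy_row n y : y < n -> nth 0 (greedy_row n) y = greedy y.
Proof.
elim: n => // n IHn; rewrite ltnS leq_eqVlt => /predU1P[-> //|lt_yn].
by rewrite /= nth_rcons size_greedy_row lt_yn IHn.
Qed.

Lemma greedyE x :
  greedy x = argmin_nat (fun v => \sum_(0 <= y < x | greedy y == v) w x y) q.
Proof.
rewrite {1}/greedy /= nth_rcons size_greedy_row ltnn eqxx.
elim: (q) => //= n ->.
suff E v : \sum_(0 <= y < x | nth 0 (greedy_row x) y == v) w x y =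
           \sum_(0 <= y < x | greedy y == v) w x y by rewrite !E.
rewrite [LHS]big_nat_cond [RHS]big_nat_cond; apply: eq_bigl => y.
by case: ltnP => //= lt_yx; rewrite nth_greedy_row.
Qed.

Hypothesis q_gt0 : 0 < q.

Lemma greedy_lt x : greedy x < q.
Proof. by rewrite greedyE argmin_nat_lt. Qed.

(** Averaging: the [q] colour classes split the total weight, and [x] joins the lightest. *)
Lemma greedy_le x :
  q * \sum_(0 <= y < x | greedy y == greedy x) w x y <= \sum_(0 <= y < x) w x y.
Proof.
have -> : \sum_(0 <= y < x) w x y =
    \sum_(v < q) \sum_(0 <= y < x | greedy y == v) w x y.
  rewrite (exchange_big_dep xpredT) //=; apply: eq_bigr => y _.
  by rewrite (big_pred1 (Ordinal (greedy_lt y))).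
rewrite -[X in X * _]card_ord -sum_nat_const; apply: leq_sum => v _.
rewrite greedyE.
exact: (argmin_nat_min (fun u => \sum_(0 <= y < x | greedy y == u) w x y)).
Qed.

End Greedy.

(* Row [j] is chosen greedily for the weights that double at each collision. *)
Fixpoint weight_at (q j : nat) : nat -> nat -> nat :=
  if j is i.+1 then fun x y =>
    weight_at q i x y *
    (if greedy (weight_at q i) q y == greedy (weight_at q i) q x then 2 else 1)
  else fun _ _ => 1.

Definition table (q j : nat) : nat -> nat := greedy (weight_at q j) q.

Definition collisions (q l x y : nat) : nat :=
  \sum_(0 <= j < l) (table q j y == table q j x).

Definition potential (q n j : nat) : nat :=
  \sum_(0 <= x < n) \sum_(0 <= y < x) weight_at q j x y.

Lemma collisionsC q l x y : collisions q l x y = collisions q l y x.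
Proof. by apply: eq_bigr => j _; rewrite eq_sym. Qed.

Lemma weight_atE q j x y : weight_at q j x y = 2 ^ collisions q j x y.
Proof.
elim: j => [|j IHj] /=; first by rewrite /collisions big_geq.
rewrite IHj /collisions big_nat_recr //= expnD; congr (_ * _).
by rewrite -/(table q j); case: eqP.
Qed.

(** At each [x] at most a share [1 / q] of the weight doubles, so one row multiplies the potential
    by at most [1 + 1 / q]. *)
Lemma potentialS q n j : 0 < q ->
  q * potential q n j.+1 <= q.+1 * potential q n j.
Proof.
move=> q0; rewrite /potential !big_distrr /=; apply: leq_sum => x _.
apply: (@leq_trans (\sum_(0 <= y < x) q * weight_at q j x y +
  q * \sum_(0 <= y < x | table q j y == table q j x) weight_at q j x y)).
  rewrite big_distrr /= [X in _ + _ * X]big_mkcond big_distrr /= -big_split /=.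
  apply: leq_sum => y _; rewrite -/(table q j).
  by case: eqP => _; rewrite ?muln0 ?muln1 ?addn0 // muln2 -addnn mulnDr.
rewrite -big_distrr /= mulSn addnC leq_add2r.
exact: greedy_le.
Qed.

(** [(1 + 1/q) ^ q <= 4]. A Bernoulli bound gives [(1 + 1/q) ^ i <= q / (q - i)]; for [i] about
    [q / 2] this yields 2, which is then squared. *)
Lemma succ_expn_le q : 0 < q -> q.+1 ^ q <= 4 * q ^ q.
Proof.
move=> q0.
have bern i : i <= q -> q.+1 ^ i * (q - i) <= q ^ i.+1.
  elim: i => [|i IHi] lt_iq; first by rewrite expn0 mul1n expn1 subn0.
  have := IHi (ltnW lt_iq); move/(leq_mul (leqnn q)); rewrite -expnS.
  apply: leq_trans; rewrite [_ ^ i.+1]expnS -mulnA mulnCA [leqRHS]mulnCA.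
  by rewrite leq_mul2l; apply/orP; right; nia.
have half : exists2 i, q <= 2 * i & q.+1 ^ i <= 2 * q ^ i.
  have Eq := odd_double_half q; case: (odd q) Eq => /= Eq.
    exists q./2.+1; first lia.
    have := bern q./2; rewrite (_ : q - q./2 = q./2.+1); last lia.
    move=> H; have {}H := H ltac:(lia).
    have E : q.+1 = 2 * q./2.+1 by lia.
    by rewrite expnS {1}E -mulnA leq_mul2l /= mulnC.
  exists q./2; first lia.
  have := bern q./2; rewrite (_ : q - q./2 = q./2); last lia.
  move=> H; have {}H := H ltac:(lia).
  have h0 : 0 < q./2 by lia.
  rewrite -(leq_pmul2r h0) (leq_trans H) // expnS {1}(_ : q = 2 * q./2); last lia.
  by rewrite mulnAC.
case: half => i le_q le_i.
have := leq_mul le_i le_i; rewrite -expnD mulnACA -expnD addnn -mul2n => H.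
rewrite -(leq_pmul2r (_ : 0 < q ^ (2 * i - q))) ?expn_gt0 ?q0 //.
rewrite -mulnA -expnD subnKC //; apply: leq_trans H.
rewrite -[in leqRHS](subnKC le_q) expnD leq_mul2l; apply/orP; right.
by case: (2 * i - q) => // d; rewrite leq_exp2r.
Qed.

(** At most [n ^ 2] pairs start with weight 1, and each block of [q] rows multiplies the potential
    by at most 4. All intermediate [j] are included because the program stores these weights in
    words. *)
Lemma potential_le q n lam j : 0 < q -> j <= q * lam ->
  potential q n j <= n ^ 2 * 4 ^ lam.
Proof.
move=> q0 le_j.
have P0 : potential q n 0 <= n ^ 2.
  rewrite /potential /=; apply: (@leq_trans (\sum_(0 <= x < n) n)).
    rewrite big_nat [leqRHS]big_nat; apply: leq_sum => x /andP[_ lt_x].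
    by rewrite sum_nat_const_nat subn0 muln1 ltnW.
  by rewrite sum_nat_const_nat subn0.
have Pj i : q ^ i * potential q n i <= q.+1 ^ i * potential q n 0.
  elim: i => [|i IHi]; first by rewrite !mul1n.
  rewrite !expnS -mulnA mulnCA.
  apply: leq_trans (_ : q ^ i * (q.+1 * potential q n i) <= _).
    by rewrite leq_mul2l potentialS ?orbT.
  by rewrite mulnCA -mulnA leq_mul2l IHi.
have qx : 0 < q ^ (q * lam) by rewrite expn_gt0 q0.
rewrite -(leq_pmul2l qx) -{1}(subnK le_j) expnD -mulnA.
apply: leq_trans (_ : q.+1 ^ (q * lam - j) * (q.+1 ^ j * n ^ 2) <= _).
  apply: leq_mul; first by case: (_ - _) => // d; rewrite leq_exp2r.
  by apply: leq_trans (Pj j) _; rewrite leq_mul2l P0 orbT.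
rewrite mulnA -expnD subnK // !expnM mulnCA mulnC leq_mul2l.
apply/orP; right; rewrite -expnMn mulnC.
by case: (lam) => // l; rewrite leq_exp2r // succ_expn_le.
Qed.

Lemma weight_at_le q n lam j x y : 0 < q -> j <= q * lam -> y < x < n ->
  weight_at q j x y <= n ^ 2 * 4 ^ lam.
Proof.
move=> q0 le_j /andP[lt_yx lt_xn]; apply: leq_trans (potential_le n q0 le_j).
rewrite /potential (bigD1_seq x) ?mem_index_iota ?iota_uniq //=.
rewrite (bigD1_seq y) ?mem_index_iota ?iota_uniq //=.
by rewrite -addnA leq_addr.
Qed.

Lemma sum_weight_at_le q n lam j x : 0 < q -> j <= q * lam -> x < n ->
  \sum_(0 <= y < x) weight_at q j x y <= n ^ 2 * 4 ^ lam.
Proof.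
move=> q0 le_j lt_xn; apply: leq_trans (potential_le n q0 le_j).
by rewrite /potential [leqRHS](bigD1_seq x) ?mem_index_iota ?iota_uniq //= leq_addr.
Qed.

(** One weight is at most the whole potential: [2 ^ collisions <= n ^ 2 * 4 ^ lam <= 2 ^ (4 *
    lam)]. *)
Lemma collisions_le q n lam x y : 0 < q -> n <= 2 ^ lam ->
  x < n -> y < n -> x != y -> collisions q (q * lam) x y <= 4 * lam.
Proof.
move=> q0 le_n; wlog lt_yx : x y / y < x => [IH lt_x lt_y ne_xy|lt_xn _ _].
  move: (ne_xy); rewrite neq_ltn => /orP[lt|lt]; last exact: IH.
  by rewrite collisionsC; apply: IH => //; rewrite eq_sym.
have := @weight_at_le q n lam (q * lam) x y q0 (leqnn _).
rewrite lt_yx lt_xn => /(_ isT); rewrite weight_atE => le_w.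
rewrite -(@leq_exp2l 2) //; apply: leq_trans le_w _.
have -> : 2 ^ (4 * lam) = (2 ^ lam) ^ 2 * 4 ^ lam.
  by rewrite -(expnM 2 2) -expnM -expnD; congr (2 ^ _); lia.
by rewrite leq_mul2r leq_exp2r // le_n orbT.
Qed.

(** With unit weights and at most [q] keys an empty colour always remains, and the lightest class is
    empty. Thus the mode [q = p], [l = 1] needs no program of its own: its table is a
    relabelling. *)
Lemma table0_inj q n x y : n <= q -> x < n -> y < n ->
  table q 0 x = table q 0 y -> x = y.
Proof.
move=> le_nq; wlog lt_yx : x y / y < x => [IH lt_x lt_y E|lt_xn _ E].
  by case: (ltngtP y x) => // lt; [apply: IH | apply/esym/IH].
have q0 : 0 < q by apply: leq_trans le_nq; apply: leq_trans lt_xn.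
have := greedy_le (weight_at q 0) q0 x; rewrite /= sum_nat_const_nat subn0 muln1.
rewrite big_mkcond (bigD1_seq y) ?mem_index_iota ?iota_uniq //=.
have -> : greedy (fun _ _ => 1) q y == greedy (fun _ _ => 1) q x.
  by apply/eqP/esym.
nia.
Qed.

(** * Reed-Solomon hashing and separating families *)

Definition digit (q n l : nat) : nat := n %/ q ^ l %% q.

Lemma digitS q n l : digit q n l.+1 = digit q (n %/ q) l.
Proof. by rewrite /digit expnS divnMA. Qed.

Lemma digit_inj q k n n' : n < q ^ k -> n' < q ^ k ->
  (forall l, l < k -> digit q n l = digit q n' l) -> n = n'.
Proof.
elim: k n n' => [|k IHk] n n'; first by rewrite !ltnS !leqn0 => /eqP-> /eqP->.
case: (posnP q) => [->|q0]; first by rewrite exp0n.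
rewrite !expnSr -!ltn_divLR // => lt_n lt_n' E.
rewrite (divn_eq n q) (divn_eq n' q).
have -> : n %% q = n' %% q by have := E 0 isT; rewrite /digit !divn1.
suff -> : n %/ q = n' %/ q by [].
by apply: IHk => // l lt_l; rewrite -!digitS E.
Qed.

Lemma digits_onto q b (tau : nat -> nat) : 0 < q -> (forall l, tau l < q) ->
  exists2 n, n < q ^ b & forall l, l < b -> digit q n l = tau l.
Proof.
move=> q0; elim: b tau => [|b IHb] tau tau_lt; first by exists 0.
have [|n lt_n digE] := IHb (tau \o succn); first by move=> l; apply: tau_lt.
have Ediv : (tau 0 + n * q) %/ q = n.
  by rewrite addnC divnMDl // divn_small ?addn0.
exists (tau 0 + n * q); first by rewrite expnSr -ltn_divLR ?Ediv.
case=> [_|l /digE /= <-]; last by rewrite digitS Ediv.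
by rewrite /digit divn1 addnC modnMDl modn_small.
Qed.

(* Horner evaluation at [x], modulo [p], of the polynomial whose coefficients
   are the first [k] base-[p] digits of [e]. *)
Fixpoint rs_hash (p x e k : nat) : nat :=
  if k is i.+1 then (rs_hash p x e i * x + digit p e i) %% p else 0.

Lemma rs_hash_lt p x e k : 0 < p -> rs_hash p x e k < p.
Proof. by case: k => //= k p0; rewrite ltn_pmod. Qed.

(** The polynomial that [rs_hash] evaluates; in Horner order digit 0 is the coefficient of
    [X ^ (k - 1)]. *)
Fixpoint rs_poly (p e k : nat) : {poly 'F_p} :=
  (if k is i.+1 then rs_poly p e i * 'X + (digit p e i)%:R%:P else 0)%R.

Lemma size_rs_poly p e k : size (rs_poly p e k) <= k.
Proof.
elim: k => [|k IHk] /=; first by rewrite size_poly0.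
rewrite size_MXaddC; case: ifP => //.
Qed.

Lemma rs_polyE p x e k : prime p ->
  ((rs_poly p e k).[x%:R] = (rs_hash p x e k)%:R)%R.
Proof.
move=> pp; elim: k => [|k IHk] /=; first by rewrite horner0.
by rewrite hornerMXaddC IHk [RHS]Fp_nat_mod // natrD natrM.
Qed.

Lemma natr_Fp_inj p i j : prime p -> i < p -> j < p ->
  (i%:R = j%:R :> 'F_p)%R -> i = j.
Proof.
by move=> pp lti ltj /(congr1 val); rewrite /= !val_Fp_nat // !modn_small.
Qed.

Lemma rs_poly_inj p e e' k : prime p -> rs_poly p e k = rs_poly p e' k ->
  forall l, l < k -> digit p e l = digit p e' l.
Proof.
move=> pp; elim: k => //= k IHk E l.
have E0 := congr1 (fun P : {poly 'F_p} => P`_0)%R E.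
rewrite /= !coefD !coefMX !coefC /= !add0r in E0.
rewrite ltnS leq_eqVlt => /predU1P[->|]; last first.
  apply: IHk; apply/polyP => i.
  have := congr1 (fun P : {poly 'F_p} => P`_i.+1)%R E.
  by rewrite /= !coefD !coefMX !coefC /= !addr0.
by apply: natr_Fp_inj E0 => //; rewrite ltn_pmod ?prime_gt0.
Qed.

(** Distinct edges have distinct digit strings, so the difference of their polynomials is nonzero of
    degree below [k]; each collision is a root of it, and the points [x < p] are distinct in
    ['F_p]. *)
Lemma rs_hash_collisions p k e e' : prime p -> e < p ^ k -> e' < p ^ k ->
  e != e' -> \sum_(0 <= x < p) (rs_hash p x e k == rs_hash p x e' k) <= k.-1.
Proof.
move=> pp lt_e lt_e' ne_e; pose P := (rs_poly p e k - rs_poly p e' k)%R.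
have P0 : P != 0%R.
  apply: contraNneq ne_e => /eqP; rewrite subr_eq0 => /eqP E.
  by apply/eqP/(digit_inj lt_e lt_e')/(rs_poly_inj pp E).
pose bad := [seq x <- index_iota 0 p | rs_hash p x e k == rs_hash p x e' k].
have -> : \sum_(0 <= x < p) (rs_hash p x e k == rs_hash p x e' k) = size bad.
  by rewrite /bad size_filter -sum1_count [RHS]big_mkcond; apply: eq_bigr => x _; case: eqP.
have rootsP : all (root P) [seq x%:R%R | x <- bad].
  apply/allP => y /mapP[x]; rewrite mem_filter => /andP[/eqP Ex _] ->.
  by rewrite rootE hornerD hornerN !rs_polyE // Ex subrr.
have uniqP : uniq [seq x%:R%R : 'F_p | x <- bad].
  rewrite map_inj_in_uniq ?filter_uniq ?iota_uniq // => x y.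
  rewrite !mem_filter !mem_index_iota => /and3P[_ _ ltx] /and3P[_ _ lty].
  exact: natr_Fp_inj.
have := max_poly_roots P0 rootsP uniqP; rewrite size_map => lt_bad.
have : size P <= k.
  by rewrite (leq_trans (size_polyD _ _)) // size_polyN geq_max !size_rs_poly.
move: lt_bad; move: (size bad) (size P) => u v; lia.
Qed.

(** * Separating two disjoint edge sets: composed hashing, then guessed colours *)

Section Covering.
Variables (p k q l m : nat).
Hypotheses (pp : prime p) (q0 : 0 < q) (le_m : m <= p ^ k).

Definition edge_hash (x j e : nat) : nat := table q j (rs_hash p x e k).

Lemma edge_hash_lt x j e : edge_hash x j e < q.
Proof. exact: greedy_lt. Qed.

(** At the at most [k - 1] points where the Reed-Solomon symbols agree, all [l] tables collide; at
    any other point at most [M] of them do. *)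
Lemma edge_hash_collisions M e e' :
  (forall u v, u < p -> v < p -> u != v -> collisions q l u v <= M) ->
  e < m -> e' < m -> e != e' ->
  \sum_(0 <= x < p) \sum_(0 <= j < l) (edge_hash x j e == edge_hash x j e')
    <= k.-1 * l + p * M.
Proof.
move=> leM lt_e lt_e' ne_e; have p0 := prime_gt0 pp.
have := rs_hash_collisions pp (leq_trans lt_e le_m) (leq_trans lt_e' le_m) ne_e.
move=> /(leq_mul (leqnn l)) le_rs.
rewrite [X in X + _]mulnC; apply: leq_trans (leq_add le_rs (leqnn (p * M))).
have -> : p * M = \sum_(0 <= x < p) M by rewrite sum_nat_const_nat subn0.
rewrite big_distrr -big_split /=; apply: leq_sum => x _.
rewrite /edge_hash; case: eqP => [->|/eqP ne_rs].
  rewrite muln1; apply: leq_trans (leq_addr _ _).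
  rewrite (eq_bigr (fun=> 1)) ?sum_nat_const_nat ?subn0 ?muln1 //.
  by move=> j _; rewrite eqxx.
rewrite muln0 add0n; apply: (leM (rs_hash p x e' k) (rs_hash p x e k)).
- exact: rs_hash_lt.
- exact: rs_hash_lt.
- by rewrite eq_sym.
Qed.

(** Union bound by counting: if none of the [p * l] functions separates, each has a colliding pair
    in [X * Y], and these pairs do not have that many collisions in total. *)
Lemma separating_hash M (X Y : {set 'I_m}) :
  (forall u v, u < p -> v < p -> u != v -> collisions q l u v <= M) ->
  [disjoint X & Y] -> #|X| * #|Y| * (k.-1 * l + p * M) < p * l ->
  exists x j, [/\ x < p, j < l &
    forall e e', e \in X -> e' \in Y -> edge_hash x j e != edge_hash x j e'].
Proof.
move=> leM disXY lt_pl.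
pose sep x j := [forall e in X, forall e' in Y, edge_hash x j e != edge_hash x j e'].
case: (boolP [exists x : 'I_p, exists j : 'I_l, sep x j]) => [|none].
  case/existsP => x /existsP[j /forall_inP sep_xj]; exists x, j; split=> //.
  by move=> e e' eX e'Y; have /forall_inP := sep_xj e eX; apply.
exfalso; move: lt_pl; rewrite ltnNge => /negP; apply.
have -> : p * l = \sum_(x < p) \sum_(j < l) 1.
  by rewrite !big_const_ord !iter_addn_0 mul1n mulnC.
apply: (@leq_trans (\sum_(x < p) \sum_(j < l) \sum_(e in X) \sum_(e' in Y)
   (edge_hash x j e == edge_hash x j e'))).
  apply: leq_sum => x _; apply: leq_sum => j _.
  move: none => /existsPn/(_ x)/existsPn/(_ j).
  rewrite negb_forall_in => /exists_inP[e eX].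
  rewrite negb_forall_in => /exists_inP[e' e'Y]; rewrite negbK => coll.
  by rewrite (bigD1 e) //= (bigD1 e') //= coll.
rewrite (eq_bigr _ (fun x _ => exchange_big _ _ _ _ _ _)) exchange_big /=.
rewrite -mulnA -sum_nat_const; apply: leq_sum => e eX.
rewrite (eq_bigr _ (fun x _ => exchange_big _ _ _ _ _ _)) exchange_big /=.
rewrite -sum_nat_const; apply: leq_sum => e' e'Y.
have ne_e : val e != val e'.
  by apply: contraTneq e'Y => /val_inj <-; rewrite (disjointFr disXY).
have := edge_hash_collisions leM (ltn_ord e) (ltn_ord e') ne_e.
by apply: leq_trans; rewrite big_mkord; apply: leq_sum => x _; rewrite big_mkord.
Qed.

Definition in_tuple_code (b i v : nat) : bool :=
  has (fun s => digit q i s == v) (iota 0 b).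

(** The base-[q] digits of [i] list the colours of [X]. *)
Lemma tuple_code_separates b (h : 'I_m -> nat) (X Y : {set 'I_m}) :
  (forall e, h e < q) -> #|X| <= b -> #|Y| < q ->
  (forall e e', e \in X -> e' \in Y -> h e != h e') ->
  exists2 i, i < q ^ b & (forall e, e \in X -> in_tuple_code b i (h e)) /\
                         (forall e, e \in Y -> ~~ in_tuple_code b i (h e)).
Proof.
move=> h_lt le_X lt_Y sepXY.
(* A colour that [Y] misses pads the tuple when [X] has fewer than [b] elements; it exists because
   [#|Y| < q]. *)
have [v v_lt vY] : exists2 v, v < q & v \notin [seq h e | e in Y].
  case: (boolP (all (mem [seq h e | e in Y]) (iota 0 q))) => [/allP sub|].
    have := uniq_leq_size (iota_uniq 0 q) sub.
    by rewrite size_iota size_map -cardE leqNgt lt_Y.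
  by case/allPn => v; rewrite mem_iota add0n => v_lt vY; exists v.
pose tau s := nth v [seq h e | e in X] s.
have tau_lt s : tau s < q.
  rewrite /tau; case: (ltnP s (size [seq h e | e in X])) => lt_s; last first.
    by rewrite nth_default.
  by have /mapP[e _ ->] := mem_nth v lt_s.
have [i lt_i digE] := digits_onto b q0 tau_lt; exists i => //; split=> e eXY.
  have hX : h e \in [seq h e | e in X] by apply: map_f; rewrite mem_enum.
  apply/hasP; exists (index (h e) [seq h e | e in X]).
    rewrite mem_iota add0n (leq_trans _ le_X) // cardE -(size_map h).
    by rewrite index_mem.
  rewrite digE; first by rewrite /tau nth_index.
  by rewrite (leq_trans _ le_X) // cardE -(size_map h) index_mem.
apply/hasPn => s; rewrite mem_iota add0n => lt_s; rewrite digE // /tau.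
case: (ltnP s (size [seq h e | e in X])) => lt_sX; last first.
  rewrite nth_default //; apply: contraNneq vY => ->.
  by apply: map_f; rewrite mem_enum.
have /mapP[e' e'X ->] := mem_nth v lt_sX.
by apply: sepXY => //; rewrite -mem_enum.
Qed.

End Covering.

(** * A structured language compiled to the word RAM *)

Inductive expr :=
  | Var of nat
  | Lit of nat
  | Arr of nat & expr
  | Bop of binop & expr & expr.

Inductive stmt :=
  | Asgn of nat & expr
  | Store of nat & expr & expr
  | Out of expr
  | Comp of stmt & stmt
  | IfS of expr & stmt & stmt
  | WhileS of nat & stmt.

Record hstate := HState {
  var : nat -> nat;
  arr : nat -> nat -> nat;
  outp : seq nat
}.

Fixpoint eval (h : hstate) (e : expr) : nat :=
  match e with
  | Var x => var h x
  | Lit n => n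
  | Arr t e => arr h t (eval h e)
  | Bop o e1 e2 => eval_op o (eval h e1) (eval h e2)
  end.

Definition set_var (x v : nat) (h : hstate) : hstate :=
  HState [eta var h with x |-> v] (arr h) (outp h).

Definition set_arr (t i v : nat) (h : hstate) : hstate :=
  HState (var h)
    (fun t' i' => if (t' == t) && (i' == i) then v else arr h t' i') (outp h).

Definition emit (v : nat) (h : hstate) : hstate :=
  HState (var h) (arr h) (rcons (outp h) v).

(** The other results are at most the first operand or at most 1, so only these operations can leave
    the word. *)
Definition grows (o : binop) : bool :=
  match o with Add | Mul => true | _ => false end.

(* Variable [x] is register [2x], the odd registers hold temporaries, and cell
   [i] of array [t] is the memory cell [5i + t]. *)
Definition tmp (r : nat) : nat := r.*2.+1.

(** Temporaries form a stack: the value ends in [tmp r] and nothing below [r] is touched. The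
    machine copies by adding to zero. *)
Fixpoint expr_code (e : expr) (r : nat) : cmd :=
  match e with
  | Var x => Seq (Const (tmp r) 0) (Op Add (tmp r) (tmp r) x.*2)
  | Lit n => Const (tmp r) n
  | Arr t e =>
      Seq (Seq (Const (tmp r) 5)
            (Seq (expr_code e r.+1)
              (Seq (Op Mul (tmp r) (tmp r) (tmp r.+1))
                (Seq (Const (tmp r.+1) t)
                     (Op Add (tmp r) (tmp r) (tmp r.+1))))))
          (Read (tmp r) (tmp r))
  | Bop o e1 e2 =>
      Seq (expr_code e1 r)
          (Seq (expr_code e2 r.+1) (Op o (tmp r) (tmp r) (tmp r.+1)))
  end.

Fixpoint expr_cost (e : expr) : nat :=
  match e with
  | Var _ => 3
  | Lit _ => 1
  | Arr _ e => expr_cost e + 10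
  | Bop _ e1 e2 => expr_cost e1 + expr_cost e2 + 3
  end.

Fixpoint stmt_code (s : stmt) : cmd :=
  match s with
  | Asgn x e =>
      Seq (expr_code e 0)
          (Seq (Const x.*2 0) (Op Add x.*2 x.*2 (tmp 0)))
  | Store t i e =>
      Seq (expr_code (Bop Add (Bop Mul (Lit 5) i) (Lit t)) 0)
          (Seq (expr_code e 1) (Write (tmp 0) (tmp 1)))
  | Out e => Seq (expr_code e 0) (Emit (tmp 0))
  | Comp s1 s2 => Seq (stmt_code s1) (stmt_code s2)
  | IfS e s1 s2 =>
      Seq (expr_code e 0) (If (tmp 0) (stmt_code s1) (stmt_code s2))
  | WhileS x s => While x.*2 (stmt_code s)
  end.

Fixpoint expr_tags (e : expr) : seq nat :=
  match e with
  | Arr t e => t :: expr_tags e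
  | Bop _ e1 e2 => expr_tags e1 ++ expr_tags e2
  | _ => [::]
  end.

Fixpoint stmt_tags (s : stmt) : seq nat :=
  match s with
  | Asgn _ e | Out e => expr_tags e
  | Store t i e => t :: expr_tags i ++ expr_tags e
  | Comp s1 s2 => stmt_tags s1 ++ stmt_tags s2
  | IfS e s1 s2 => expr_tags e ++ stmt_tags s1 ++ stmt_tags s2
  | WhileS _ s => stmt_tags s
  end.

(** * Correctness of the compilation, with exact step counts *)

Section Semantics.
Variable W : nat.
Hypothesis W_gt5 : 5 < W.

Fixpoint fits (h : hstate) (e : expr) : bool :=
  match e with
  | Var _ => true
  | Lit n => n < W
  | Arr t e => fits h e && (5 * eval h e + t < W)
  | Bop o e1 e2 =>
      [&& fits h e1, fits h e2
        & grows o ==> (eval_op o (eval h e1) (eval h e2) < W)]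
  end.

(* [big_step s h n h'] : from [h], the code of [s] ends in [h'] after exactly
   [n] steps of the machine. *)
Inductive big_step : stmt -> hstate -> nat -> hstate -> Prop :=
  | BsAsgn x e h : fits h e ->
      big_step (Asgn x e) h (expr_cost e + 4) (set_var x (eval h e) h)
  | BsStore t i e h : fits h i -> fits h e -> 5 * eval h i + t < W ->
      big_step (Store t i e) h (expr_cost i + expr_cost e + 11)
        (set_arr t (eval h i) (eval h e) h)
  | BsOut e h : fits h e ->
      big_step (Out e) h (expr_cost e + 2) (emit (eval h e) h)
  | BsComp s1 s2 h n1 h1 n2 h2 :
      big_step s1 h n1 h1 -> big_step s2 h1 n2 h2 ->
      big_step (Comp s1 s2) h (n1 + n2).+1 h2
  | BsIf e s1 s2 h n h' : fits h e ->
      big_step (if eval h e != 0 then s1 else s2) h n h' ->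
      big_step (IfS e s1 s2) h (expr_cost e + n.+1).+1 h'
  | BsWhileEnd x s h : var h x = 0 -> big_step (WhileS x s) h 1 h
  | BsWhile x s h n1 h1 n2 h2 : var h x != 0 ->
      big_step s h n1 h1 -> big_step (WhileS x s) h1 n2 h2 ->
      big_step (WhileS x s) h (n1 + n2).+1 h2.

Definition runs (c : cmd) (st : state) (n : nat) (st' : state) : Prop :=
  forall k, steps W n (c :: k, st) = Some (k, st').

Lemma runs_seq c1 c2 st n1 st1 n2 st2 :
  runs c1 st n1 st1 -> runs c2 st1 n2 st2 ->
  runs (Seq c1 c2) st (n1 + n2).+1 st2.
Proof.
move=> r1 r2 k; rewrite /steps iterSr /= addnC iterD.
by have := r1 (c2 :: k); rewrite /steps => ->; apply: r2.
Qed.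

Lemma runs_set c r v st :
  (forall k, step W (c :: k, st) = omap (pair k) (set_reg W r v st)) ->
  v < W -> runs c st 1 (State [eta reg st with r |-> v] (Defs.mem st) (out st)).
Proof.
by move=> stepE ltv k; rewrite -[LHS]/(step W (c :: k, st)) stepE /set_reg ltv.
Qed.

(** The last two fields make reads, copies and non-growing operations safe without side
    conditions. *)
Record represents (h : hstate) (st : state) : Prop := Represents {
  rep_var : forall x, reg st x.*2 = var h x;
  rep_arr : forall t i, t < 5 -> Defs.mem st (5 * i + t) = arr h t i;
  rep_out : out st = outp h;
  rep_regW : forall r, reg st r < W;
  rep_memW : forall a, Defs.mem st a < W
}.

Lemma tmpE r r' : (tmp r == tmp r') = (r == r').
Proof. by rewrite /tmp eqSS -!muln2 eqn_mul2r. Qed.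

Lemma var_tmpE x r : (x.*2 == tmp r) = false.
Proof. by apply/eqP; rewrite /tmp => /(congr1 odd); rewrite /= !odd_double. Qed.

Lemma tmp_varE x r : (tmp r == x.*2) = false.
Proof. by rewrite eq_sym var_tmpE. Qed.

Lemma represents_tmp h st r v : represents h st -> v < W ->
  represents h (State [eta reg st with tmp r |-> v] (Defs.mem st) (out st)).
Proof.
move=> [Rv Ra Ro Rr Rm] ltv; split=> //= [x|r'].
  by rewrite var_tmpE.
by case: ifP.
Qed.

Lemma reg_set f r v mu o : reg (State [eta f with r |-> v] mu o) r = v.
Proof. by rewrite /= eqxx. Qed.

Lemma runs_op o r x y st :
  (forall r, reg st r < W) ->
  grows o ==> (eval_op o (reg st x) (reg st y) < W) ->
  eval_op o (reg st x) (reg st y) < W /\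
  runs (Op o r x y) st 1
   (State [eta reg st with r |-> eval_op o (reg st x) (reg st y)]
      (Defs.mem st) (out st)).
Proof.
move=> regW growsW; have ltW : eval_op o (reg st x) (reg st y) < W.
  case: o growsW => //= _.
  - by rewrite (leq_ltn_trans (leq_subr _ _)).
  - by rewrite (leq_ltn_trans (leq_div _ _)).
  - by rewrite (leq_ltn_trans (leq_mod _ _)).
  - by case: (reg st x < _); lia.
  - by case: (_ == _); lia.
by split=> //; apply: runs_set.
Qed.

(** The last conjunct is the stack discipline: the first operand, or the constant 5 of an address,
    survives the evaluation of what comes after it. *)
Lemma expr_code_runs h e r st :
  represents h st -> fits h e -> all (ltn^~ 5) (expr_tags e) ->
  exists st', [/\ runs (expr_code e r) st (expr_cost e) st', represents h st',
    reg st' (tmp r) = eval h e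
    & forall r', r' < r -> reg st' (tmp r') = reg st (tmp r')].
Proof.
elim: e r st => [x|n|t e IHe|o e1 IHe1 e2 IHe2] r st Rst /=.
- move=> _ _; set st1 := State [eta reg st with tmp r |-> 0] (Defs.mem st) (out st).
  have r1 : runs (Const (tmp r) 0) st 1 st1 by apply: runs_set => //; lia.
  have R1 : represents h st1 by apply: represents_tmp => //; lia.
  have [|ltW r2] := @runs_op Add (tmp r) (tmp r) x.*2 st1 (rep_regW R1).
    by rewrite /= eqxx var_tmpE (rep_regW Rst).
  eexists; split; first exact: runs_seq r1 r2.
  + exact: represents_tmp.
  + by rewrite /= !eqxx var_tmpE (rep_var Rst).
  + by move=> r' lt_r'; rewrite /= tmpE (ltn_eqF lt_r').
- move=> ltn _; exists (State [eta reg st with tmp r |-> n] (Defs.mem st) (out st)).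
  split; first exact: runs_set.
  + exact: represents_tmp.
  + by rewrite /= eqxx.
  + by move=> r' lt_r'; rewrite /= tmpE (ltn_eqF lt_r').
- case/andP=> fe ltW /andP[lt_t te].
  set st1 := State [eta reg st with tmp r |-> 5] (Defs.mem st) (out st).
  have r1 : runs (Const (tmp r) 5) st 1 st1 by apply: runs_set => //; lia.
  have R1 : represents h st1 by apply: represents_tmp.
  have [st2 [r2 R2 E2 F2]] := IHe r.+1 st1 R1 fe te.
  have E2' : reg st2 (tmp r) = 5 by rewrite F2 //= eqxx.
  have [|lt3 r3] := @runs_op Mul (tmp r) (tmp r) (tmp r.+1) st2 (rep_regW R2).
    by rewrite /= E2 E2'; lia.
  have R3 := represents_tmp r R2 lt3; set st3 := State _ _ _ in r3 R3.
  set st4 := State [eta reg st3 with tmp r.+1 |-> t] (Defs.mem st3) (out st3).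
  have r4 : runs (Const (tmp r.+1) t) st3 1 st4 by apply: runs_set => //; lia.
  have R4 : represents h st4 by apply: represents_tmp => //; lia.
  have Er1 : reg st4 (tmp r.+1) = t by rewrite /= eqxx.
  have Er0 : reg st4 (tmp r) = 5 * eval h e.
    by rewrite /= tmpE (ltn_eqF (ltnSn r)) eqxx E2 E2'.
  have [|lt5 r5] := @runs_op Add (tmp r) (tmp r) (tmp r.+1) st4 (rep_regW R4).
    by rewrite implyTb -[eval_op _ _ _]/(reg st4 _ + reg st4 _) Er1 Er0.
  have R5 := represents_tmp r R4 lt5; set st5 := State _ _ _ in r5 R5.
  have E5 : reg st5 (tmp r) = 5 * eval h e + t.
    by rewrite /st5 reg_set -[LHS]/(reg st4 _ + reg st4 _) Er1 Er0.
  have lt6 : Defs.mem st5 (reg st5 (tmp r)) < W by exact: rep_memW R5 _.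
  have r6 : runs (Read (tmp r) (tmp r)) st5 1
      (State [eta reg st5 with tmp r |-> Defs.mem st5 (reg st5 (tmp r))]
         (Defs.mem st5) (out st5)) by apply: runs_set.
  eexists; split.
  + have := runs_seq (runs_seq r1 (runs_seq r2 (runs_seq r3 (runs_seq r4 r5)))) r6.
    by congr runs; lia.
  + exact: represents_tmp R5 lt6.
  + by rewrite reg_set E5 (rep_arr R5).
  + move=> r' lt_r'; rewrite /= !tmpE (ltn_eqF lt_r') (ltn_eqF (ltnW lt_r' : r' < r.+1)).
    by rewrite (F2 _ (leqW lt_r')) /= tmpE (ltn_eqF lt_r').
- case/and3P=> f1 f2 ltW; rewrite all_cat => /andP[t1 t2].
  have [st1 [r1 R1 E1 F1]] := IHe1 r st Rst f1 t1.
  have [st2 [r2 R2 E2 F2]] := IHe2 r.+1 st1 R1 f2 t2.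
  have E2' : reg st2 (tmp r) = eval h e1 by rewrite F2.
  have [|lt3 r3] := @runs_op o (tmp r) (tmp r) (tmp r.+1) st2 (rep_regW R2).
    by rewrite E2 E2'.
  eexists; split.
  + by have := runs_seq r1 (runs_seq r2 r3); congr runs; lia.
  + exact: represents_tmp.
  + by rewrite /= eqxx E2 E2'.
  + by move=> r' lt_r'; rewrite /= tmpE (ltn_eqF lt_r') (F2 _ (leqW lt_r')) F1.
Qed.

Lemma stmt_code_runs s h n h' st :
  big_step s h n h' -> represents h st -> all (ltn^~ 5) (stmt_tags s) ->
  exists2 st', runs (stmt_code s) st n st' & represents h' st'.
Proof.
move=> bs; elim: bs st => {s h n h'}.
- move=> x e h fe st Rst te.
  have [st1 [r1 R1 E1 _]] := expr_code_runs 0 Rst fe te.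
  have lt0W : 0 < W by lia.
  set st2 := State [eta reg st1 with x.*2 |-> 0] (Defs.mem st1) (out st1).
  have r2 : runs (Const x.*2 0) st1 1 st2 by apply: runs_set.
  have regW2 r : reg st2 r < W by rewrite /=; case: ifP => // _; apply: rep_regW R1 _.
  have [|lt3 r3] := @runs_op Add x.*2 x.*2 (tmp 0) st2 regW2.
    by rewrite /= eqxx tmp_varE (rep_regW R1).
  exists (State [eta reg st2 with x.*2 |-> eval h e] (Defs.mem st2) (out st2)).
    have E : eval_op Add (reg st2 x.*2) (reg st2 (tmp 0)) = eval h e.
      by rewrite /= eqxx tmp_varE E1.
    rewrite E in r3.
    by have := runs_seq r1 (runs_seq r2 r3); congr runs; lia.
  have ltW : eval h e < W by rewrite -E1; apply: rep_regW R1 _.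
  case: R1 => Rv Ra Ro Rr Rm; split=> //= [y|r].
    by rewrite -!muln2 eqn_mul2r /= muln2; case: ifP => // ->.
  by case: ifP => // ->.
- move=> t i e h fi fe ltW st Rst /= /andP[lt_t]; rewrite all_cat => /andP[ti te].
  have fa : fits h (Bop Add (Bop Mul (Lit 5) i) (Lit t)).
    by rewrite /= W_gt5 fi; apply/and3P; split; lia.
  have ta : all (ltn^~ 5) (expr_tags (Bop Add (Bop Mul (Lit 5) i) (Lit t))).
    by rewrite /= cats0.
  have [st1 [r1 R1 E1 _]] := expr_code_runs 0 Rst fa ta.
  have [st2 [r2 R2 E2 F2]] := expr_code_runs 1 R1 fe te.
  have Ea : reg st2 (tmp 0) = 5 * eval h i + t by rewrite F2.
  exists (State (reg st2)
    [eta Defs.mem st2 with 5 * eval h i + t |-> eval h e] (out st2)).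
    have r3 : runs (Write (tmp 0) (tmp 1)) st2 1
        (State (reg st2) [eta Defs.mem st2 with 5 * eval h i + t |-> eval h e] (out st2)).
      by move=> k; rewrite /steps /= E2 Ea.
    by have := runs_seq r1 (runs_seq r2 r3); congr runs => /=; lia.
  have ltE : eval h e < W by rewrite -E2; apply: rep_regW R2 _.
  case: R2 => Rv Ra Ro Rr Rm; split=> //= [t' i' lt_t'|a]; last by case: ifP.
  have -> : (5 * i' + t' == 5 * eval h i + t) = (t' == t) && (i' == eval h i) by lia.
  by rewrite Ra.
- move=> e h fe st Rst te.
  have [st1 [r1 R1 E1 _]] := expr_code_runs 0 Rst fe te.
  exists (State (reg st1) (Defs.mem st1) (rcons (out st1) (eval h e))).
    have r2 : runs (Emit (tmp 0)) st1 1
      (State (reg st1) (Defs.mem st1) (rcons (out st1) (eval h e))).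
      by move=> k; rewrite /steps /= -/(tmp 0) E1.
    by have := runs_seq r1 r2; congr runs; lia.
  by case: R1 => Rv Ra Ro Rr Rm; split=> //=; rewrite Ro.
- move=> s1 s2 h n1 h1 n2 h2 _ IH1 _ IH2 st Rst /=.
  rewrite all_cat => /andP[t1 t2].
  have [st1 r1 R1] := IH1 st Rst t1; have [st2 r2 R2] := IH2 st1 R1 t2.
  by exists st2 => //; apply: runs_seq r1 r2.
- move=> e s1 s2 h n h' fe _ IH st Rst /=.
  rewrite !all_cat => /and3P[te t1 t2].
  have [st1 [r1 R1 E1 _]] := expr_code_runs 0 Rst fe te.
  have [|st2 r2 R2] := IH st1 R1; first by case: ifP.
  exists st2 => //; apply: runs_seq r1 _ => k.
  have := r2 k; rewrite /steps iterSr /= -/(tmp 0) E1.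
  by case: ifP.
- move=> x s h x0 st Rst /= ts; exists st => //.
  by move=> k; rewrite /steps /= (rep_var Rst) x0.
- move=> x s h n1 h1 n2 h2 xn0 _ IH1 _ IH2 st Rst /= ts.
  have [st1 r1 R1] := IH1 st Rst ts; have [st2 r2 R2] := IH2 st1 R1 ts.
  exists st2 => // k; rewrite /steps iterSr /= (rep_var Rst) xn0 addnC iterD.
  by have := r1 (While x.*2 (stmt_code s) :: k); rewrite /steps => ->; apply: r2.
Qed.

End Semantics.

(** * Weakest preconditions with step counts *)

Fixpoint vars_set (s : stmt) : seq nat :=
  match s with
  | Asgn x _ => [:: x]
  | Comp s1 s2 | IfS _ s1 s2 => vars_set s1 ++ vars_set s2
  | WhileS _ s => vars_set s
  | _ => [::]
  end.

Fixpoint arrs_set (s : stmt) : seq nat :=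
  match s with
  | Store t _ _ => [:: t]
  | Comp s1 s2 | IfS _ s1 s2 => arrs_set s1 ++ arrs_set s2
  | WhileS _ s => arrs_set s
  | _ => [::]
  end.

Fixpoint emits (s : stmt) : bool :=
  match s with
  | Out _ => true
  | Comp s1 s2 | IfS _ s1 s2 => emits s1 || emits s2
  | WhileS _ s => emits s
  | _ => false
  end.

(** Read off from the syntax, so that loop invariants only mention what the loop changes. *)
Record frame (s : stmt) (h h' : hstate) : Prop := Frame {
  frame_var : forall x, x \notin vars_set s -> var h' x = var h x;
  frame_arr : forall t i, t \notin arrs_set s -> arr h' t i = arr h t i;
  frame_out : ~~ emits s -> outp h' = outp h
}.

Lemma frame_trans s h1 h2 h3 : frame s h1 h2 -> frame s h2 h3 -> frame s h1 h3.
Proof.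
move=> [v1 a1 o1] [v2 a2 o2]; split=> [x nx|t i nt|no].
- by rewrite v2 ?v1.
- by rewrite a2 ?a1.
- by rewrite o2 ?o1.
Qed.

Lemma frame_sub s s' h h' :
  {subset vars_set s <= vars_set s'} -> {subset arrs_set s <= arrs_set s'} ->
  (emits s -> emits s') -> frame s h h' -> frame s' h h'.
Proof.
move=> sv sa so [v1 a1 o1]; split=> [x nx|t i nt|no].
- by apply: v1; apply: contra nx; apply: sv.
- by apply: a1; apply: contra nt; apply: sa.
- by apply: o1; apply: contra no.
Qed.

Lemma big_step_frame W s h n h' : big_step W s h n h' -> frame s h h'.
Proof.
elim=> {s h n h'} //.
- by move=> x e h _; split=> //= y; rewrite inE => /negbTE->.
- by move=> t i e h _ _ _; split=> //= t' i'; rewrite inE => /negbTE->.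
- move=> s1 s2 h n1 h1 n2 h2 _ f1 _ f2.
  apply: (@frame_trans _ _ h1).
    by apply: frame_sub f1 => /= [x|x|->]; rewrite ?mem_cat // => ->.
  by apply: frame_sub f2 => /= [x|x|->]; rewrite ?mem_cat ?orbT // => ->; rewrite orbT.
- move=> e s1 s2 h n h' _ _; case: ifP => _ f.
    by apply: frame_sub f => /= [x|x|->]; rewrite ?mem_cat // => ->.
  by apply: frame_sub f => /= [x|x|->]; rewrite ?mem_cat ?orbT // => ->; rewrite orbT.
- move=> x s h n1 h1 n2 h2 _ _ f1 _ f2; apply: frame_trans f2.
  by apply: frame_sub f1.
Qed.

Section WeakestPrecondition.
Variable W : nat.

Definition wp (s : stmt) (t : nat) (Q : hstate -> Prop) (h : hstate) : Prop :=
  exists n h', [/\ n <= t, big_step W s h n h' & Q h'].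

Lemma wp_le t s t' Q h : wp s t Q h -> t <= t' -> wp s t' Q h.
Proof.
by move=> [n [h' [le_n bs Qh]]] le_t; exists n, h'; split=> //; apply: leq_trans le_t.
Qed.

Lemma wp_conseq (P Q : hstate -> Prop) s t h :
  wp s t P h -> (forall h', frame s h h' -> P h' -> Q h') -> wp s t Q h.
Proof.
move=> [n [h' [le_n bs Ph]]] PQ; exists n, h'; split=> //; apply: PQ => //.
exact: big_step_frame bs.
Qed.

Lemma wp_asgn x e Q h :
  fits W h e -> Q (set_var x (eval h e) h) -> wp (Asgn x e) (expr_cost e + 4) Q h.
Proof. by move=> fe Qh; exists (expr_cost e + 4), (set_var x (eval h e) h); split=> //; apply: BsAsgn. Qed.

Lemma wp_store t i e Q h :
  fits W h i -> fits W h e -> 5 * eval h i + t < W ->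
  Q (set_arr t (eval h i) (eval h e) h) ->
  wp (Store t i e) (expr_cost i + expr_cost e + 11) Q h.
Proof.
move=> fi fe lt Qh; exists (expr_cost i + expr_cost e + 11).
by exists (set_arr t (eval h i) (eval h e) h); split=> //; apply: BsStore.
Qed.

Lemma wp_out e Q h :
  fits W h e -> Q (emit (eval h e) h) -> wp (Out e) (expr_cost e + 2) Q h.
Proof.
move=> fe Qh; exists (expr_cost e + 2), (emit (eval h e) h).
by split=> //; apply: BsOut.
Qed.

Lemma wp_comp s1 s2 t1 t2 Q h :
  wp s1 t1 (wp s2 t2 Q) h -> wp (Comp s1 s2) (t1 + t2).+1 Q h.
Proof.
move=> [n1 [h1 [le1 b1 [n2 [h2 [le2 b2 Qh]]]]]].
exists (n1 + n2).+1, h2; split=> //; first by rewrite ltnS leq_add.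
exact: BsComp b1 b2.
Qed.

(** Both branches are charged: a sum keeps the time bounds polynomial, where a maximum would bring
    case distinctions. *)
Lemma wp_if e s1 s2 t1 t2 Q h :
  fits W h e -> (eval h e != 0 -> wp s1 t1 Q h) ->
  (eval h e = 0 -> wp s2 t2 Q h) ->
  wp (IfS e s1 s2) (expr_cost e + (t1 + t2) + 2) Q h.
Proof.
move=> fe w1 w2.
have [n [h' [le_n b Qh]]] :
    wp (if eval h e != 0 then s1 else s2) (t1 + t2) Q h.
  case: ifP => [/w1|/negbFE/eqP/w2] w; apply: wp_le w _.
    exact: leq_addr.
  exact: leq_addl.
exists (expr_cost e + n.+1).+1, h'; split=> //; first lia.
exact: BsIf.
Qed.

Lemma wp_while N x s t (I : nat -> hstate -> Prop) Q h :
  I 0 h ->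
  (forall i h', i < N -> frame s h h' -> I i h' ->
     var h' x != 0 /\ wp s t (I i.+1) h') ->
  (forall h', frame s h h' -> I N h' -> var h' x = 0 /\ Q h') ->
  wp (WhileS x s) (N * t.+1 + 1) Q h.
Proof.
move=> I0 Istep Iend.
suff main d : forall i h', N = d + i -> frame s h h' -> I i h' ->
    wp (WhileS x s) (d * t.+1 + 1) Q h'.
  by apply: (main N 0 h) => //; rewrite addn0.
elim: d => [|d IHd] i h1 EN f1 Ii.
  rewrite add0n in EN; subst i; have [x0 Qh] := Iend h1 f1 Ii.
  by exists 1, h1; split=> //; apply: BsWhileEnd.
have [|xn0 [n1 [h2 [le1 b1 I2]]]] := Istep i h1 _ f1 Ii; first by rewrite EN addSn ltnS leq_addl.
have [||n2 [h3 [le2 b2 Qh]]] := IHd i.+1 h2 _ _ I2; first by rewrite EN addSnnS.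
  by apply: frame_trans f1 _; apply: big_step_frame b1.
exists (n1 + n2).+1, h3; split=> //; last exact: BsWhile b1 b2.
by rewrite mulSn; lia.
Qed.

(* The guard of the loop on [x] is kept in its own variable: machine loops test a
   register, not an expression. *)
Definition loop_flag (x : nat) : nat := x + 50.

Definition For (x y : nat) (s : stmt) : stmt :=
  let test := Asgn (loop_flag x) (Bop Ltn (Var x) (Var y)) in
  Comp (Asgn x (Lit 0)) (Comp test
    (WhileS (loop_flag x)
       (Comp s (Comp (Asgn x (Bop Add (Var x) (Lit 1))) test)))).

Definition set_loop (x v u : nat) (h : hstate) : hstate :=
  set_var (loop_flag x) u (set_var x v h).

(** Quantifying over [v] and [u] makes the invariant insensitive to counter and flag; the counter
    value is supplied separately. The overhead 27 is 11 for the increment, 13 for the test, 2 for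
    sequencing and 1 for the guard; 21 is the initialization with one test and the final exit. *)
Lemma wp_for n x y s t (I : nat -> hstate -> Prop) Q h :
  1 < W -> n < W -> var h y = n ->
  [&& y \notin vars_set (For x y s), x \notin vars_set s & x != loop_flag x] ->
  (forall v u, I 0 (set_loop x v u h)) ->
  (forall i h', i < n -> frame (For x y s) h h' -> var h' x = i -> I i h' ->
     wp s t (fun h'' => forall v u, I i.+1 (set_loop x v u h'')) h') ->
  (forall h', frame (For x y s) h h' -> I n h' -> Q h') ->
  wp (For x y s) (n * (t + 27) + 21) Q h.
Proof.
move=> W1 lt_nW Ey /and3P[ny nx nxf] I0 Istep Iend; rewrite /For.
have [ynx ynf] : y != x /\ y != loop_flag x.
  by split; apply: contra ny => /eqP->; rewrite !inE eqxx ?orbT.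
have frameF u h1 : frame (Comp s (Comp (Asgn x (Bop Add (Var x) (Lit 1)))
      (Asgn (loop_flag x) (Bop Ltn (Var x) (Var y)))))
    (set_loop x 0 u h) h1 -> frame (For x y s) h h1.
  move=> f1; apply: (@frame_trans _ _ (set_loop x 0 u h)).
    split=> //= z; rewrite !inE !negb_or => /and3P[/negbTE zx /negbTE zf _].
    by rewrite zf zx.
  by apply: frame_sub f1 => //= z H; rewrite !inE H !orbT.
apply: wp_le.
  apply: wp_comp; apply: wp_asgn; first by rewrite /= ltnW.
  apply: wp_comp; apply: wp_asgn => //.
  apply: (@wp_while n _ _ (t + 26) (fun i h' => [/\ var h' x = i,
     var h' (loop_flag x) = (i < n) & I i h'])).
  - split; rewrite /= ?eqxx ?(negbTE nxf) // ?eqxx //.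
    by rewrite (negbTE ynx) Ey.
    exact: I0.
  - move=> i h1 lt_in f1 [Ex Ef Ii]; rewrite Ef lt_in; split=> //.
    have fF := frameF _ _ f1.
    apply: (@wp_le (t + (expr_cost (Bop Add (Var x) (Lit 1)) + 4 +
      (expr_cost (Bop Ltn (Var x) (Var y)) + 4)).+1).+1); last by rewrite /=; lia.
    apply: wp_comp; apply: wp_conseq (Istep i h1 lt_in fF Ex Ii) _ => h2 f2 I2.
    have Ex2 : var h2 x = i by rewrite (frame_var f2).
    have Ey2 : var h2 y = n.
      rewrite (frame_var f2) ?(frame_var fF) //.
      by apply: contra ny => sy; rewrite !inE mem_cat sy !orbT.
    apply: wp_comp; apply: wp_asgn; first by rewrite /= W1 Ex2 addn1; lia.
    apply: wp_asgn => //; split; last exact: I2.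
      by rewrite /= (negbTE nxf) eqxx Ex2 addn1.
    by rewrite /= eqxx (negbTE ynx) eqxx Ex2 Ey2 addn1.
  - move=> h1 f1 [Ex Ef In]; rewrite Ef ltnn; split=> //.
    by apply: Iend => //; apply: frameF f1.
by rewrite /=; lia.
Qed.

End WeakestPrecondition.

(** * Choosing the parameters *)

Declare Scope prog_scope.
Delimit Scope prog_scope with P.
Bind Scope prog_scope with expr stmt.
Arguments Store _%_nat _%_P _%_P.
Arguments Out _%_P.
Arguments IfS _%_P _%_P _%_P.
Arguments Arr _%_nat _%_P.
Arguments WhileS _%_nat _%_P.
Arguments For _%_nat _%_nat _%_P.
#[local] Coercion Var : nat >-> expr.
Local Notation "a + b" := (Bop Add a b) : prog_scope.
Local Notation "a - b" := (Bop Defs.Sub a b) : prog_scope.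
Local Notation "a * b" := (Bop Mul a b) : prog_scope.
Local Notation "a %/ b" := (Bop Div a b) : prog_scope.
Local Notation "a %% b" := (Bop Mod a b) : prog_scope.
Local Notation "a < b" := (Bop Ltn a b) : prog_scope.
Local Notation "a == b" := (Bop Eqn a b) : prog_scope.
Local Notation "x <~ e" := (Asgn x e%P) (at level 80, e at level 79) : prog_scope.
Local Notation "s1 ;; s2" := (Comp s1%P s2%P)
  (at level 95, right associativity) : prog_scope.

Local Notation vm := 0 (only parsing).
Local Notation vL := 1 (only parsing).
Local Notation vf := 2 (only parsing).
Local Notation vb := 3 (only parsing).
Local Notation vflip := 4 (only parsing).
Local Notation vB := 5 (only parsing).
Local Notation vk := 6 (only parsing).
Local Notation vp := 7 (only parsing).
Local Notation vlam := 8 (only parsing).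
Local Notation vq := 9 (only parsing).
Local Notation vl := 10 (only parsing).
Local Notation vt := 11 (only parsing).
Local Notation vu := 12 (only parsing).
Local Notation vgo := 13 (only parsing).
Local Notation vpp := 14 (only parsing).
Local Notation vnop := 15 (only parsing).
Local Notation vx := 20 (only parsing).
Local Notation vj := 21 (only parsing).
Local Notation vi := 22 (only parsing).
Local Notation ve := 23 (only parsing).
Local Notation vv := 24 (only parsing).
Local Notation vy := 25 (only parsing).

Definition nop : stmt := Asgn vnop (Lit 0).

(* Truncated subtraction computes minima: [x - (x - y) = minn x y]. *)
Definition read_params : stmt := (
  vm <~ Arr 1 (Lit 0) ;;
  vt <~ vm + Lit 1 ;;
  vL <~ Arr 2 (Lit 0) ;;
  vL <~ vL - (vL - vt) ;;
  vf <~ Arr 3 (Lit 0) ;;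
  vf <~ vf - (vf - vt) ;;
  vb <~ vL - (vL - vf) ;;
  vflip <~ vL < vf ;;
  vB <~ Lit 2 * (vL * vf))%P.

(* Multiplication stops at [lim], so that the powers fit in a word. *)
Definition capped_power (n base lim : nat) : stmt := (
  vt <~ Lit 1 ;;
  For vy n (IfS (vt < lim) (vt <~ vt * base) nop))%P.

Definition find_degree : stmt := (
  vk <~ Lit 0 ;;
  vgo <~ Lit 1 ;;
  WhileS vgo (
    vk <~ vk + Lit 1 ;;
    vu <~ vk * vB ;;
    capped_power vk vu vm ;;
    vgo <~ vt < vm))%P.

(** Trial division: truncated subtraction turns [vt] from 1 to 0 at the first divisor and keeps it
    there. *)
Definition find_prime : stmt := (
  vp <~ vu - Lit 1 ;;
  vgo <~ Lit 1 ;;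
  WhileS vgo (
    vp <~ vp + Lit 1 ;;
    vt <~ Lit 1 ;;
    For vy vp (vt <~ vt - (Lit 1 < vy) * (vp %% vy == Lit 0)) ;;
    vgo <~ vt == Lit 0))%P.

Definition find_log : stmt := (
  vlam <~ Lit 0 ;;
  vt <~ Lit 1 ;;
  For vy vp (IfS (vt < vp) (vt <~ Lit 2 * vt ;; vlam <~ vlam + Lit 1) nop))%P.

Definition choose_mode : stmt := (
  vu <~ (vL * vf) * vlam ;;
  capped_power vb vk vu ;;
  IfS (vt < vu) (vq <~ vp ;; vl <~ Lit 1)
                (vq <~ Lit 4 * vB ;; vl <~ vq * vlam))%P.

Section Verification.
Variable W : nat.
Hypothesis W_gt5 : 5 < W.

Lemma subn_min a b : a - (a - b) = minn a b.
Proof. by rewrite minnC minnE; case: (leqP b a) => ?; lia. Qed.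

Lemma read_params_ok m L f h :
  let L' := minn L m.+1 in let f' := minn f m.+1 in
  arr h 1 0 = m -> arr h 2 0 = L -> arr h 3 0 = f ->
  m.+1 < W -> 2 * (L' * f') < W ->
  wp W read_params 200 (fun h' =>
    [/\ var h' vm = m, var h' vL = L' /\ var h' vf = f', var h' vb = minn L' f',
        var h' vflip = (L' < f') :> nat & var h' vB = 2 * (L' * f')]) h.
Proof.
move=> L' f' Em EL Ef lt_m lt_B; apply: wp_le.
  rewrite /read_params.
  apply: wp_comp; apply: wp_asgn; first by rewrite /=; lia.
  apply: wp_comp; apply: wp_asgn; first by rewrite /= Em; lia.
  apply: wp_comp; apply: wp_asgn; first by rewrite /=; lia.
  apply: wp_comp; apply: wp_asgn => //.
  apply: wp_comp; apply: wp_asgn; first by rewrite /=; lia.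
  apply: wp_comp; apply: wp_asgn => //.
  apply: wp_comp; apply: wp_asgn => //.
  apply: wp_comp; apply: wp_asgn => //.
  apply: wp_asgn.
    rewrite /= Em EL Ef !subn_min addn1 -/L' -/f'; lia.
  by rewrite /= Em EL Ef !subn_min addn1 -/L' -/f'; split.
by [].
Qed.

Lemma capped_power_ok c base lim vn vbase vlim h :
  var h vn = c -> var h vbase = base -> var h vlim = lim ->
  0 < base -> c < W -> lim * base < W ->
  all (fun x => x \notin [:: vt; vy; loop_flag vy; vnop]) [:: vn; vbase; vlim] ->
  wp W (capped_power vn vbase vlim) (c * 80 + 40) (fun h' =>
    (var h' vt < lim) = (base ^ c < lim)) h.
Proof.
move=> En Eb El b0 ltc ltW /=; rewrite !inE !negb_or andbT -!andbA.
case/and3P=> n1 n2 /and3P[n3 n4] /and5P[b1 b2 b3 b4] /and4P[l1 l2 l3 l4].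
apply: wp_le.
  apply: wp_comp; apply: wp_asgn; first by rewrite /=; lia.
  apply: (@wp_for _ c _ _ _ _ (fun i h' =>
    (var h' vt < lim -> var h' vt = base ^ i) /\
    (lim <= var h' vt -> lim <= base ^ i))) => //.
  - lia.
  - by rewrite /= (negbTE n1).
  - by rewrite /= !inE !negb_or n1 n2 n3 n4.
  - move=> i h1 lt_i f1 _ [I1 I2].
    have Eb1 : var h1 vbase = base.
      by rewrite (frame_var f1) /= ?(negbTE b1) // !inE !negb_or b1 b2 b3 b4.
    have El1 : var h1 vlim = lim.
      by rewrite (frame_var f1) /= ?(negbTE l1) // !inE !negb_or l1 l2 l3 l4.
    apply: wp_if => //=; rewrite El1.
      case: ltnP => // lt_t _; have Et := I1 lt_t; apply: wp_asgn.
        by rewrite /= Eb1 (leq_ltn_trans _ ltW) // leq_mul2r ltnW ?orbT.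
      move=> v u /=; rewrite Eb1 Et -expnSr; split=> //.
    case: ltnP => // le_t _; have le_b := I2 le_t; apply: wp_asgn => /=; first lia.
    move=> v u; split=> [|_]; first by rewrite ltnNge le_t.
    by rewrite expnS (leq_trans le_b) // leq_pmull.
  - move=> h1 f1 [I1 I2]; case: ltnP => [lt_t|/I2].
      by rewrite -I1.
    by rewrite leqNgt => /negbTE.
rewrite /=; lia.
Qed.

Lemma find_degree_ok m B k h :
  var h vm = m -> var h vB = B -> 0 < B ->
  0 < k -> m <= (k * B) ^ k ->
  (forall k', 0 < k' < k -> (k' * B) ^ k' < m) ->
  k < W -> k * B < W -> m * (k * B) < W ->
  wp W find_degree (k * (k * 80 + 200) + 20) (fun h' =>
    var h' vk = k /\ var h' vu = k * B) h.
Proof.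
move=> Em EB B0 k0 le_m min_k lt_k lt_kB lt_mkB; apply: wp_le.
  apply: wp_comp; apply: wp_asgn; first by rewrite /=; lia.
  apply: wp_comp; apply: wp_asgn; first by rewrite /=; lia.
  apply: (@wp_while _ k _ _ _ (fun i h' => [/\ var h' vk = i,
    var h' vgo = (i < k) & 0 < i -> var h' vu = i * B])) => //=.
    by rewrite k0.
  move=> i h1 lt_i f1 [Ek Eg Eu]; rewrite Eg lt_i; split=> //.
  have Em1 : var h1 vm = m by rewrite (frame_var f1).
  have EB1 : var h1 vB = B by rewrite (frame_var f1).
  have lt_iB : i.+1 * B <= k * B by rewrite leq_mul2r lt_i orbT.
  apply: wp_comp; apply: wp_asgn; first by rewrite /= Ek; lia.
  apply: wp_comp; apply: wp_asgn.
    by rewrite /= Ek EB1 addn1; apply: leq_ltn_trans lt_iB lt_kB.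
  apply: wp_comp; apply: wp_conseq.
    apply: (@wp_le _ (i.+1 * 80 + 40) _ (k * 80 + 40)); last by lia.
    apply: (@capped_power_ok i.+1 (i.+1 * B) m) => //=.
    - by rewrite Ek addn1.
    - by rewrite Ek EB1 addn1.
    - by rewrite muln_gt0.
    - lia.
    - by rewrite (leq_ltn_trans _ lt_mkB) // leq_mul2l lt_iB orbT.
  move=> h2 f2 Et.
  have Ek2 : var h2 vk = i.+1 by rewrite (frame_var f2) //= Ek addn1.
  have Eu2 : var h2 vu = i.+1 * B by rewrite (frame_var f2) //= Ek EB1 addn1.
  have Em2 : var h2 vm = m by rewrite (frame_var f2).
  apply: wp_asgn => //=; rewrite Ek2 Eu2 Em2 Et; split=> //.
  move: lt_i; rewrite leq_eqVlt => /predU1P[->|lt_i].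
    by rewrite ltnn ltnNge le_m.
  by rewrite min_k // lt_i.
by move=> h1 _ [-> -> Eu]; rewrite ltnn Eu.
rewrite /=; lia.
Qed.

Fixpoint no_divisor_below (p n : nat) : bool :=
  if n is y.+1 then no_divisor_below p y && ~~ ((1 < y) && (p %% y == 0))
  else true.

Lemma no_divisor_prime p : 1 < p -> no_divisor_below p p = prime p.
Proof.
move=> p1; have ndP n : reflect (forall y, 1 < y < n -> ~~ (y %| p)) (no_divisor_below p n).
  elim: n => [|n IHn] /=; first by left; move=> y; rewrite ltn0 andbF.
  apply: (iffP andP) => [[/IHn nd ny] y | nd].
    rewrite [y < _]ltnS [y <= n]leq_eqVlt => /andP[y1 /predU1P[Ey|lty]].
      by move: ny; rewrite -Ey y1.
    by apply: nd; rewrite y1.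
  split; first by apply/IHn => y /andP[y1 lty]; rewrite nd // y1 ltnW.
  by case: ltnP => //= n1; rewrite -/(dvdn n p) nd // n1 leqnn.
apply/ndP/primeP => [nd|[_ prime_p] y /andP[y1 lty]].
  split=> // d dp; have d_gt0 : 0 < d by apply: dvdn_gt0 dp; lia.
  have le_d : d <= p by apply: dvdn_leq => //; lia.
  have := nd d; rewrite dp /=; case: eqP => //= d1; case: eqP => //= dp'.
  by move=> H; have := H ltac:(lia).
apply/negP => /prime_p /orP[/eqP y1'|/eqP Ey]; lia.
Qed.

Lemma find_prime_ok n p h :
  var h vu = n -> 1 < n -> prime p -> n <= p ->
  (forall p', n <= p' < p -> ~~ prime p') -> p.+1 < W ->
  wp W find_prime ((p - n).+1 * (p * 80 + 100) + 40) (fun h' => var h' vp = p) h.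
Proof.
move=> Eu n1 pp le_np min_p lt_p; apply: wp_le.
  apply: wp_comp; apply: wp_asgn; first by rewrite /=; lia.
  apply: wp_comp; apply: wp_asgn; first by rewrite /=; lia.
  apply: (@wp_while _ (p - n).+1 _ _ _ (fun i h' =>
    var h' vp = n.-1 + i /\ var h' vgo = (i < (p - n).+1))) => //=.
    by rewrite Eu; lia.
  move=> i h1 lt_i _ [Ep Eg]; rewrite Eg lt_i; split=> //.
  apply: wp_comp; apply: wp_asgn; first by rewrite /= Ep; lia.
  apply: wp_comp; apply: wp_asgn; first by rewrite /=; lia.
  apply: wp_comp; apply: (@wp_le _ ((n + i) * (40 + 27) + 21) _ (p * 67 + 21)); last lia.
  apply: (@wp_for _ (n + i) _ _ _ _ (fun y h' =>
    var h' vt = no_divisor_below (n + i) y)) => //=; try lia.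
    move=> y h2 lt_y f2 Ey Et.
    have Ep2 : var h2 vp = n + i.
      by rewrite (frame_var f2) //= Ep; lia.
    apply: wp_le.
      apply: wp_asgn; rewrite /= Ey Ep2.
        by case: (1 < y); case: (_ %% _ == 0); rewrite /=; lia.
      by move=> _ _; rewrite Et; case: no_divisor_below; case: ltnP => _; case: eqP.
    by [].
  move=> h2 f2 Et; apply: wp_asgn; first by rewrite /=; lia.
  rewrite /= Et (frame_var f2) //= Ep no_divisor_prime; last lia.
  split; first lia.
  case: (ltnP i.+1 (p - n).+1) => lt_i1.
    by rewrite (negbTE (min_p _ _)) //; lia.
  have -> : n + i = p by lia.
  by rewrite pp.
by move=> h1 _ [-> ->]; rewrite ltnn; split=> //; lia.
rewrite /=; nia.
Qed.

Lemma find_log_ok p h :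
  var h vp = p -> 1 < p -> p * 2 < W ->
  wp W find_log (p * 100 + 60) (fun h' => var h' vlam = up_log 2 p) h.
Proof.
move=> Ep p1 lt_p; apply: wp_le.
  apply: wp_comp; apply: wp_asgn; first by rewrite /=; lia.
  apply: wp_comp; apply: wp_asgn; first by rewrite /=; lia.
  apply: (@wp_for _ p _ _ _ _ (fun i h' => exists a,
    [/\ var h' vlam = a, var h' vt = 2 ^ a, 0 < a -> 2 ^ a.-1 < p, a <= i
      & 2 ^ a < p -> a = i])) => //=; try lia.
  - by move=> _ _; exists 0.
  - move=> i h1 lt_i f1 _ [a [Ea Et lt_a le_ai Eai]].
    have Ep1 : var h1 vp = p by rewrite (frame_var f1).
    apply: wp_if => //=; rewrite Et Ep1.
      case: ltnP => // lt_2a _; apply: wp_comp; apply: wp_asgn => /=.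
        by rewrite Et; lia.
      apply: wp_asgn => /=; first by rewrite Ea; lia.
      move=> _ _; exists a.+1; rewrite Ea Et addn1 expnS; split=> //.
      by move=> _; rewrite Eai.
    case: ltnP => // le_2a _; apply: wp_asgn => /=; first lia.
    move=> _ _; exists a; split=> //; first exact: leqW.
    by rewrite ltnNge le_2a.
  - move=> h1 _ [a [-> _ lt_a le_a Eap]].
    (* The [p] rounds suffice: if [2 ^ a] were still below [p], every round would have doubled, so
       [a = p], but [p < 2 ^ p]. *)
    have le_p : p <= 2 ^ a.
      by rewrite leqNgt; apply/negP => lt2; have := ltn_expl p (isT : 1 < 2); rewrite -{2}(Eap lt2); lia.
    case: a lt_a le_p {le_a Eap} => [|a] lt_a le_p; first by rewrite expn0 in le_p; lia.
    by apply/esym/up_log_eq => //; rewrite le_p lt_a.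
rewrite /=; lia.
Qed.

(** Up to constants the direct mode costs [(k L f) ^ b.+1] and the greedy one
    [k L f * (L f lam) * (L f) ^ b]; the quotient is [k ^ b] against [L f lam]. *)
Definition greedy_mode (L f lam k b : nat) : bool := L * f * lam <= k ^ b.

Lemma choose_mode_ok L f B b k p lam h :
  var h vL = L -> var h vf = f -> var h vb = b -> var h vk = k ->
  var h vp = p -> var h vlam = lam -> var h vB = B -> 0 < k ->
  L * f < W -> L * f * lam * k < W -> b < W -> 4 * B < W -> 4 * B * lam < W ->
  let g := greedy_mode L f lam k b in
  wp W choose_mode (b * 80 + 200) (fun h' =>
    var h' vq = (if g then 4 * B else p) /\
    var h' vl = (if g then 4 * B * lam else 1)) h.
Proof.
move=> EL Ef Eb Ek Ep El EB k0 lt1 lt2 lt3 lt4 lt5 g; apply: wp_le.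
  apply: wp_comp; apply: wp_asgn.
    rewrite /= EL Ef El lt1 /= (leq_ltn_trans _ lt2) //.
    by rewrite leq_pmulr.
  apply: wp_comp; apply: wp_conseq.
    apply: (@capped_power_ok b k (L * f * lam)) => //=.
    by rewrite EL Ef El.
  move=> h1 f1 /= Et.
  have Eu : var h1 vu = L * f * lam by rewrite (frame_var f1) //= EL Ef El.
  apply: wp_if => //=; rewrite Eu Et.
    case: ltnP => // ltu _; apply: wp_comp; apply: wp_asgn => //.
    apply: wp_asgn => /=; first lia.
    by rewrite (frame_var f1) //= Ep /g /greedy_mode leqNgt ltu.
  case: ltnP => // leu _; apply: wp_comp; apply: wp_asgn.
    by rewrite /= (frame_var f1) //= EB; lia.
  apply: wp_asgn => /=; rewrite !(frame_var f1) //= EB El //.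
  by rewrite /g /greedy_mode leu.
rewrite /=; lia.
Qed.

End Verification.

(** * Computing the hash table *)

Definition fill (t n c : nat) : stmt := For vv n (Store t vv (Lit c)).

Definition fill_buckets : stmt :=
  For vy vx (
    vu <~ Arr 0 (vj * vp + vy) ;;
    Store 2 vu (Arr 2 vu + Arr 1 (vx * vp + vy)))%P.

Definition find_lightest : stmt := (
  vt <~ Lit 0 ;;
  For vv vq (IfS (Arr 2 vv < Arr 2 vt) (vt <~ vv) nop))%P.

Definition double_weights : stmt :=
  For vy vx (
    IfS (Arr 0 (vj * vp + vy) == vt)
      (Store 1 (vx * vp + vy) (Lit 2 * Arr 1 (vx * vp + vy))) nop)%P.

(* Arrays: 0 the table, row by row; 1 the weights; 2 the buckets. *)
Definition fill_table : stmt := (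
  vpp <~ vp * vp ;;
  fill 1 vpp 1 ;;
  For vj vl (For vx vp (
    fill 2 vq 0 ;;
    fill_buckets ;;
    find_lightest ;;
    Store 0 (vj * vp + vx) vt ;;
    double_weights)))%P.

Section Table.
Variables W D : nat.
(** [D] bounds indices and contents alike; the factor 5 leaves room for the address [5 * i + t]. *)
Hypothesis D_W : 5 * D + 5 <= W.

Lemma fill_ok n c t vn h :
  var h vn = n -> n <= D -> 0 < D -> c <= D -> t < 5 ->
  vn \notin [:: vv; loop_flag vv] ->
  wp W (fill t vn c) (n * 60 + 30) (fun h' => forall v, v < n -> arr h' t v = c) h.
Proof.
move=> En le_n D0 le_c lt_t; rewrite !inE !negb_or => /andP[n1 n2].
apply: wp_le; first apply: (@wp_for _ n _ _ _ _ (fun i h' =>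
    forall v, v < i -> arr h' t v = c)) => //; try lia.
- by rewrite /= !inE !negb_or n1 n2.
- move=> i h1 lt_i _ Ei Ih; apply: wp_store => //=.
  + lia.
  + by rewrite Ei; lia.
  + move=> _ _ v; rewrite ltnS eqxx Ei leq_eqVlt => /predU1P[->|lt_v] /=.
      by rewrite eqxx.
    by rewrite (ltn_eqF lt_v) Ih.
rewrite /=; lia.
Qed.

Variables p q l lam : nat.
Hypotheses (q0 : 0 < q) (p1 : 1 < p) (le_l : l <= q * lam).
Hypotheses (lpD : l * p <= D) (ppD : p * p <= D) (qD : q <= D).
Hypothesis wD : 2 * (p ^ 2 * 4 ^ lam) <= D.

Let pD : p <= D. Proof. by nia. Qed.
Let lD : l <= D. Proof. by nia. Qed.

Lemma index_eq x y x' y' : y < p -> y' < p ->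
  (x * p + y == x' * p + y') = (x == x') && (y == y').
Proof.
move=> lty lty'; apply/eqP/andP => [E|[/eqP-> /eqP->] //].
have p0 : 0 < p by lia.
have Ex : x = x'.
  have := congr1 (divn^~ p) E.
  by rewrite !divnMDl // !divn_small ?addn0.
by move: E; rewrite Ex => /addnI ->; rewrite !eqxx.
Qed.

Lemma index_lt n x y : x < n -> y < p -> x * p + y < n * p.
Proof. by move=> ltx lty; nia. Qed.

Lemma fill_buckets_ok j x w g h :
  var h vp = p -> var h vj = j -> var h vx = x -> j < l -> x < p ->
  (forall y, y < x -> arr h 0 (j * p + y) = g y) ->
  (forall y, g y < q) ->
  (forall y, y < x -> arr h 1 (x * p + y) = w y) ->
  \sum_(0 <= y < x) w y <= D ->
  (forall v, v < q -> arr h 2 v = 0) ->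
  wp W fill_buckets (x * 150 + 30) (fun h' =>
    forall v, v < q -> arr h' 2 v = \sum_(0 <= y < x | g y == v) w y) h.
Proof.
move=> Ep Ej Ex ltj ltx Eg g_lt Ew le_w E0.
apply: wp_le; first apply: (@wp_for _ x _ _ _ _ (fun i h' =>
    forall v, v < q -> arr h' 2 v = \sum_(0 <= y < i | g y == v) w y)) => //; try lia.
- by move=> ? ? v lt_v; rewrite big_geq //=; apply: E0.
- move=> i h1 lt_i f1 Ei Ih.
  have lti : i < p by lia.
  have Ep1 : var h1 vp = p by rewrite (frame_var f1).
  have Ej1 : var h1 vj = j by rewrite (frame_var f1).
  have Ex1 : var h1 vx = x by rewrite (frame_var f1).
  have i1 := index_lt ltj lti; have i2 := index_lt ltx lti.
  have Eg1 : arr h1 0 (j * p + i) = g i by rewrite (frame_arr f1) // Eg.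
  have Ew1 : arr h1 1 (x * p + i) = w i by rewrite (frame_arr f1) // Ew.
  apply: wp_comp; apply: wp_asgn.
    by rewrite /= Ep1 Ej1 Ei; lia.
  have lt_g := g_lt i.
  have le_sum v : \sum_(0 <= y < i | g y == v) w y + w i <= D.
    apply: leq_trans le_w; rewrite (@big_cat_nat _ _ _ i 0 x) //=; last exact: ltnW.
    rewrite [X in _ <= _ + X]big_ltn // addnA; apply: leq_trans (leq_addr _ _).
    by rewrite leq_add2r [leqLHS]big_mkcond leq_sum // => y _; case: ifP.
  apply: wp_store => /=; rewrite ?Ep1 ?Ej1 ?Ei ?Ex1 ?Eg1; try lia.
    by rewrite Ih // Ew1; have := le_sum (g i); lia.
  move=> ? ? v ltv /=; rewrite big_mkcond big_nat_recr //= -big_mkcond /=.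
  rewrite eq_sym; case: eqP => [<-|_]; last by rewrite addn0 Ih.
  by rewrite Ih // Ew1.
rewrite /=; lia.
Qed.

Lemma find_lightest_ok s h :
  var h vq = q -> (forall v, v < q -> arr h 2 v = s v) ->
  wp W find_lightest (q * 80 + 40) (fun h' => var h' vt = argmin_nat s q) h.
Proof.
move=> Eq Es; apply: wp_le.
  apply: wp_comp; apply: wp_asgn; first by rewrite /=; lia.
  apply: (@wp_for _ q _ _ _ _ (fun i h' => var h' vt = argmin_nat s i)) => //; try lia.
  move=> i h1 lti f1 Ei Et.
  have lt_t : argmin_nat s i < q.
    by case: (posnP i) => [->//|i0]; apply: leq_trans (argmin_nat_lt s i0) (ltnW lti).
  have Ea v : v < q -> arr h1 2 v = s v by move=> ltv; rewrite (frame_arr f1) //= Es.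
  apply: wp_if; rewrite /= Et Ei.
  - by rewrite /= ; apply/andP; split; lia.
  - rewrite !Ea //; case: (boolP (s i < s _)) => // lt_s _.
    by apply: wp_asgn => //=; rewrite Ei lt_s.
  - rewrite !Ea //; case: (boolP (s i < s _)) => // lt_s _.
    by apply: wp_asgn => /=; [lia | move=> ? ?; exact: Et].
rewrite /=; lia.
Qed.

Lemma double_weights_ok j x t h :
  var h vp = p -> var h vj = j -> var h vx = x -> var h vt = t ->
  j < l -> x < p ->
  (forall y, y < x -> 2 * arr h 1 (x * p + y) <= D) ->
  wp W double_weights (x * 200 + 30) (fun h' =>
    forall x' y, x' < p -> y < x' -> arr h' 1 (x' * p + y) =
      if x' == x then arr h 1 (x' * p + y) *
        (if arr h 0 (j * p + y) == t then 2 else 1)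
      else arr h 1 (x' * p + y)) h.
Proof.
move=> Ep Ej Ex Et ltj ltx le_w.
apply: wp_le; first apply: (@wp_for _ x _ _ _ _ (fun i h' =>
    forall x' y, x' < p -> y < x' -> arr h' 1 (x' * p + y) =
      if (x' == x) && (y < i) then arr h 1 (x' * p + y) *
        (if arr h 0 (j * p + y) == t then 2 else 1)
      else arr h 1 (x' * p + y))) => //; try lia.
- by move=> ? ? x' y _ _; rewrite ltn0 andbF.
- move=> i h1 lt_i f1 Ei Ih.
  have lti : i < p by lia.
  have Ep1 : var h1 vp = p by rewrite (frame_var f1).
  have Ej1 : var h1 vj = j by rewrite (frame_var f1).
  have Ex1 : var h1 vx = x by rewrite (frame_var f1).
  have Et1 : var h1 vt = t by rewrite (frame_var f1).
  have i1 := index_lt ltj lti; have i2 := index_lt ltx lti.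
  have Eg1 : arr h1 0 (j * p + i) = arr h 0 (j * p + i) by rewrite (frame_arr f1).
  have Ew1 : arr h1 1 (x * p + i) = arr h 1 (x * p + i).
    by rewrite Ih // eqxx ltnn.
  apply: wp_if; rewrite /= ?Ep1 ?Ej1 ?Ei ?Et1 ?Eg1; first lia.
    case: (eqVneq (arr h 0 _) t) => // Eh _; apply: wp_store => /=; rewrite ?Ep1 ?Ex1 ?Ei ?Ew1; try lia.
      by have := le_w i lt_i; lia.
    move=> ? ? x' y ltx' lty /=; rewrite index_eq //; last by lia.
    case: (eqVneq x' x) => [?|ne] /=; last by rewrite Ih // (negbTE ne).
    subst x'.
    rewrite ltnS leq_eqVlt; case: (eqVneq y i) => [->|_] /=.
      by rewrite Eh eqxx mulnC.
    by rewrite Ih // eqxx.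
  case: (eqVneq (arr h 0 _) t) => // ne_t _; apply: wp_asgn => /=; first lia.
  move=> ? ? x' y ltx' lty; rewrite Ih //.
  case: (eqVneq x' x) => [->|ne] //=.
  rewrite [y < i.+1]ltnS [y <= i]leq_eqVlt; case: (eqVneq y i) => [->|_] //=.
  by rewrite ltnn (negbTE ne_t) muln1.
- move=> h1 _ Ih x' y ltx' lty; rewrite Ih //.
  by case: (eqVneq x' x) => [E|//]; rewrite -E lty.
rewrite /=; lia.
Qed.

Lemma fill_table_ok h :
  var h vp = p -> var h vq = q -> var h vl = l ->
  wp W fill_table (p * p * 60 + l * p * (q * 140 + p * 350 + 400) + l * 100 + 100)
    (fun h' => forall j x, j < l -> x < p -> arr h' 0 (j * p + x) = table q j x) h.
Proof.
move=> Ep Eq El; apply: wp_le.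
  apply: wp_comp; apply: wp_asgn; first by rewrite /= Ep; lia.
  apply: wp_comp; apply: wp_conseq.
    by apply: (@fill_ok (p * p)) => //=; rewrite ?Ep //; lia.
  move=> h1 f1 E1; rewrite /fill_table.
  have Ep1 : var h1 vp = p by rewrite (frame_var f1).
  have Eq1 : var h1 vq = q by rewrite (frame_var f1).
  have El1 : var h1 vl = l by rewrite (frame_var f1).
  apply: (@wp_for _ l _ _ _ _ (fun j h' =>
    (forall x y, x < p -> y < x -> arr h' 1 (x * p + y) = weight_at q j x y) /\
    (forall j' x, j' < j -> x < p -> arr h' 0 (j' * p + x) = table q j' x))) => //; try lia.
  - move=> ? ?; split=> //= x y ltx lty; apply: E1; first by apply: index_lt => //; lia.
  - move=> j h2 ltj f2 Ej [Iw It].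
    have Ep2 : var h2 vp = p by rewrite (frame_var f2).
    have Eq2 : var h2 vq = q by rewrite (frame_var f2).
    (* Weight rows before [x] already belong to stage [j.+1]: the colour of [x] reads only weight
       row [x], which can therefore be updated as soon as that colour is known. *)
    apply: (@wp_for _ p _ _ _ _ (fun x h' =>
      [/\ forall x' y, x' < p -> y < x' -> arr h' 1 (x' * p + y) =
            weight_at q (if x' < x then j.+1 else j) x' y,
          forall j' x', j' < j -> x' < p -> arr h' 0 (j' * p + x') = table q j' x'
        & forall x', x' < x -> arr h' 0 (j * p + x') = table q j x'])) => //; try lia.
    + move=> x h3 ltx f3 Ex [Jw Jt Jg].
      have Ep3 : var h3 vp = p by rewrite (frame_var f3).
      have Eq3 : var h3 vq = q by rewrite (frame_var f3).
      have Ej3 : var h3 vj = j by rewrite (frame_var f3).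
      apply: wp_comp; apply: wp_conseq; first by apply: (@fill_ok q) => //; lia.
      move=> h4 f4 E4.
      apply: wp_comp; apply: wp_conseq.
        apply: (@wp_le _ (x * 150 + 30) _ (p * 150 + 30)); last lia.
        apply: (@fill_buckets_ok j x (weight_at q j x) (table q j)) => //.
        * by rewrite (frame_var f4).
        * by rewrite (frame_var f4).
        * by rewrite (frame_var f4).
        * by move=> y lty; rewrite (frame_arr f4) // Jg.
        * by move=> y; apply: greedy_lt.
        * by move=> y lty; rewrite (frame_arr f4) // Jw // ltnn.
        * apply: leq_trans wD; apply: leq_trans (leq_pmull _ _) => //.
          by apply: sum_weight_at_le => //; lia.
      move=> h5 f5 E5.
      apply: wp_comp; apply: wp_conseq.
        apply: (@find_lightest_ok _ h5); last exact: E5.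
        by rewrite (frame_var f5) // (frame_var f4).
      move=> h6 f6; rewrite -greedyE -/(table q j x) => Et6.
      have v6 z : z \notin [:: vt; vu; vv; loop_flag vv; vy; loop_flag vy; vnop] ->
          var h6 z = var h3 z.
        rewrite !inE !negb_or => /and5P[z1 z2 z3 z4] /and3P[z5 z6 z7].
        rewrite (frame_var f6) ?(frame_var f5) ?(frame_var f4) //= !inE !negb_or;
          by rewrite ?z1 ?z2 ?z3 ?z4 ?z5 ?z6 ?z7.
      have a6 t i : t != 2 -> arr h6 t i = arr h3 t i.
        move=> t2; rewrite (frame_arr f6) // (frame_arr f5) ?inE //.
        by rewrite (frame_arr f4) // inE.
      have Ep6 : var h6 vp = p by rewrite v6.
      have Ej6 : var h6 vj = j by rewrite v6.
      have Ex6 : var h6 vx = x by rewrite v6.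
      have ijx := index_lt ltj ltx.
      apply: wp_comp; apply: wp_store; rewrite /= ?Ep6 ?Ej6 ?Ex6 ?Et6; try lia.
      apply: wp_conseq.
        apply: (@wp_le _ (x * 200 + 30) _ (p * 200 + 30)); last lia.
        apply: (@double_weights_ok j x (table q j x)) => //= y lty.
        rewrite a6 // Jw // ltnn; apply: leq_trans wD; rewrite leq_mul2l /=.
        by apply: weight_at_le => //; lia.
      move=> h7 f7 /= E7 ? ? /=; split.
      * move=> x' y ltx' lty; rewrite E7 // !a6 // Jw //.
        case: (eqVneq x' x) => [E|ne]; last first.
          rewrite [x' < x.+1]ltnS [x' <= x]leq_eqVlt (negbTE ne) //.
        subst x'; rewrite ltnn ltnSn /= index_eq //; last lia.
        by rewrite eqxx (ltn_eqF lty) /= Jg.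
      * move=> j' x' ltj' ltx'; rewrite (frame_arr f7) //= index_eq //.
        by rewrite (ltn_eqF ltj') /= a6 // Jt.
      * move=> x' ltx'; rewrite (frame_arr f7) //= index_eq //; last lia.
        rewrite eqxx /=; case: (eqVneq x' x) => [->//|ne].
        by rewrite a6 // Jg // ltn_neqAle ne.
    + move=> h3 f3 [Jw Jt Jg] ? ?; split=> /= [x y ltx lty|j' x ltj' ltx].
        by rewrite Jw // ltx.
      move: ltj'; rewrite ltnS leq_eqVlt => /predU1P[->|ltj']; first exact: Jg.
      exact: Jt.
  - by move=> h2 _ [_ It].
rewrite /=; nia.
Qed.

End Table.

(** * Enumerating the subgraphs *)

(** Run with 1 and later with 0 on the same tuple: erasing takes [O(b)] steps instead of [O(q)]. *)
Definition mark (c : nat) : stmt := For vi vb (Store 4 (Arr 3 vi) (Lit c)).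

(** If [vflip] is 1 the tuple guesses the colours of the path, and marked edges are kept; otherwise
    it guesses those of the faults, and unmarked edges are kept. *)
Definition emit_edges : stmt :=
  For ve vm (
    vt <~ Lit 0 ;;
    vu <~ ve ;;
    For vi vk (vt <~ (vt * vx + vu %% vp) %% vp ;; vu <~ vu %/ vp) ;;
    Out (Arr 4 (Arr 0 (vj * vp + vt)) == vflip))%P.

Definition next_tuple : stmt := (
  vt <~ Lit 1 ;;
  For vi vb (
    vu <~ Arr 3 vi + vt ;;
    Store 3 vi (vu %% vq) ;;
    vt <~ vu %/ vq))%P.

(* Arrays: 0 the table; 3 the base-[vq] digits of the tuple; 4 its indicator. *)
Definition emit_collection : stmt := (
  fill 4 vq 0 ;;
  fill 3 vb 0 ;;
  For vx vp (For vj vl (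
    vgo <~ Lit 1 ;;
    WhileS vgo (
      mark 1 ;;
      emit_edges ;;
      Out (Lit 2) ;;
      mark 0 ;;
      next_tuple ;;
      vgo <~ Lit 1 - vt))))%P.

(** Addition of 1 with carry: [q ^ s %| i.+1] is the carry into position [s], and [u] the digit with
    that carry added. *)
Lemma digit_succ q i s : 0 < q ->
  let u := digit q i s + (q ^ s %| i.+1) in
  digit q i.+1 s = u %% q /\ (q ^ s.+1 %| i.+1) = u %/ q :> nat.
Proof.
move=> q0 u; have qs0 n : 0 < q ^ n by rewrite expn_gt0 q0.
rewrite /u /digit divnS //; split; first by rewrite modnDml addnC.
have := divnS i (qs0 s.+1); rewrite expnSr divnMA divnS // [in RHS]divnMA.
rewrite {1}(divn_eq (i %/ q ^ s) q) addnCA divnMDl // addnC => /addIn <-.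
by rewrite addnC.
Qed.

Lemma digit_expn q b s : 0 < q -> s < b -> digit q (q ^ b) s = 0.
Proof.
move=> q0 lts; rewrite /digit -(subnKC lts) addSnnS expnD mulKn ?expn_gt0 ?q0 //.
by rewrite expnS modnMr.
Qed.

Section Output.
Variables W D : nat.
Hypothesis D_W : 5 * D + 5 <= W.
Variables p q l k b m : nat.
Variable flip : bool.
Hypotheses (q0 : 0 < q) (p1 : 1 < p).
Hypotheses (lpD : l * p <= D) (ppD : p * p <= D) (qD : q <= D).
Hypotheses (kD : k <= D) (bD : b <= D) (mD : m <= D).

Let pD : p <= D. Proof. by nia. Qed.
Let lD : l <= D. Proof. by nia. Qed.

Lemma iota0S n : iota 0 n.+1 = rcons (iota 0 n) n.
Proof. by rewrite -addn1 iotaD cats1. Qed.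

Lemma mark_ok c d h :
  var h vb = b -> (forall s, s < b -> arr h 3 s = d s) ->
  (forall s, s < b -> d s < q) -> c < 2 ->
  wp W (mark c) (b * 60 + 30) (fun h' => forall v,
    arr h' 4 v = if has (fun s => d s == v) (iota 0 b) then c else arr h 4 v) h.
Proof.
move=> Eb Ed d_lt c2; apply: wp_le; first apply: (@wp_for _ b _ _ _ _
  (fun i h' => forall v, arr h' 4 v =
    if has (fun s => d s == v) (iota 0 i) then c else arr h 4 v)) => //; try lia.
- move=> i h1 lti f1 Ei Ih.
  have Ed1 : arr h1 3 i = d i by rewrite (frame_arr f1) // Ed.
  have := d_lt i lti => lt_d.
  apply: wp_store.
  + by rewrite /= Ei; lia.
  + by rewrite /=; lia.
  + by rewrite /= Ei Ed1; lia.
  move=> ? ? v; rewrite iota0S has_rcons /= Ei Ed1 eq_sym.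
  by case: (d i == v); rewrite //= Ih.
rewrite /=; lia.
Qed.

Lemma emit_edges_ok (c : nat -> bool) x j h :
  var h vm = m -> var h vk = k -> var h vp = p -> var h vx = x ->
  var h vj = j -> var h vflip = flip -> x < p -> j < l ->
  (forall y, y < p -> arr h 0 (j * p + y) = table q j y) ->
  (forall v, v < q -> arr h 4 v = c v) ->
  wp W emit_edges (m * (k * 120 + 200) + 30) (fun h' => outp h' =
    outp h ++ [seq nat_of_bool (c (edge_hash p k q x j e) == flip) | e <- iota 0 m]) h.
Proof.
move=> Em Ek Ep Ex Ej Ef ltx ltj Et Ec.
apply: wp_le; first apply: (@wp_for _ m _ _ _ _ (fun i h' => outp h' =
    outp h ++ [seq nat_of_bool (c (edge_hash p k q x j e) == flip) | e <- iota 0 i])) => //; try lia.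
- by move=> ? ?; rewrite cats0.
- move=> e h1 lte f1 Ee Ih.
  have Ek1 : var h1 vk = k by rewrite (frame_var f1).
  have Ep1 : var h1 vp = p by rewrite (frame_var f1).
  have Ex1 : var h1 vx = x by rewrite (frame_var f1).
  have Ej1 : var h1 vj = j by rewrite (frame_var f1).
  have Ef1 : var h1 vflip = flip by rewrite (frame_var f1).
  apply: wp_comp; apply: wp_asgn; first by rewrite /=; lia.
  apply: wp_comp; apply: wp_asgn => //.
  apply: wp_comp; apply: (@wp_for _ k _ _ _ _ (fun i h' =>
    var h' vt = rs_hash p x e i /\ var h' vu = e %/ p ^ i)) => //; try lia.
    + by move=> ? ? /=; rewrite Ee divn1.
    + move=> i h2 lti f2 Ei [Et2 Eu2].
      have Ep2 : var h2 vp = p by rewrite (frame_var f2).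
      have Ex2 : var h2 vx = x by rewrite (frame_var f2).
      have lt_r := rs_hash_lt x e i (ltnW p1).
      have lt_d := ltn_pmod (e %/ p ^ i) (ltnW p1).
      apply: wp_comp; apply: wp_asgn.
        rewrite /= Et2 Ex2 Eu2 Ep2; nia.
      apply: wp_asgn => //= ? ?; rewrite Et2 Ex2 Eu2 Ep2.
      by rewrite expnSr divnMA.
  move=> h2 f2 [Et2 Eu2].
  have lt_r := rs_hash_lt x e k (ltnW p1).
  have ijr : j * p + rs_hash p x e k < l * p by nia.
  have Er : arr h2 0 (j * p + rs_hash p x e k) = edge_hash p k q x j e.
    by rewrite (frame_arr f2) //= (frame_arr f1) //= Et.
  have lt_h : edge_hash p k q x j e < q by apply: edge_hash_lt.
  have Ec2 : arr h2 4 (edge_hash p k q x j e) = c (edge_hash p k q x j e).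
    by rewrite (frame_arr f2) //= (frame_arr f1) //= Ec.
  have Ej2 : var h2 vj = j by rewrite (frame_var f2).
  have Ep2 : var h2 vp = p by rewrite (frame_var f2).
  have Ef2 : var h2 vflip = flip by rewrite (frame_var f2).
  apply: wp_out; first by rewrite /= Ej2 Ep2 Et2 Er; lia.
  move=> ? ?; rewrite iota0S map_rcons /= Ej2 Ep2 Et2 Er Ec2 Ef2.
  rewrite (frame_out f2) //= Ih rcons_cat.
  by congr (_ ++ rcons _ _); case: (c _); case: flip.
rewrite /=; nia.
Qed.

Lemma next_tuple_ok i h :
  var h vb = b -> var h vq = q -> (forall s, s < b -> arr h 3 s = digit q i s) ->
  wp W next_tuple (b * 100 + 50) (fun h' =>
    (forall s, s < b -> arr h' 3 s = digit q i.+1 s) /\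
    var h' vt = (q ^ b %| i.+1)) h.
Proof.
move=> Eb Eq Ed; apply: wp_le.
  apply: wp_comp; apply: wp_asgn; first by rewrite /=; lia.
  apply: (@wp_for _ b _ _ _ _ (fun s h' => (forall s', s' < b ->
     arr h' 3 s' = if s' < s then digit q i.+1 s' else digit q i s') /\
     var h' vt = (q ^ s %| i.+1))) => //; try lia.
  - by move=> ? ?; split=> /= [s lts|]; rewrite ?Ed // expn0 dvd1n.
  - move=> s h1 lts f1 Es [Ih It].
    have Eq1 : var h1 vq = q by rewrite (frame_var f1).
    have Es1 : arr h1 3 s = digit q i s by rewrite Ih // ltnn.
    have lt_d : digit q i s < q by rewrite ltn_pmod.
    have [D1 D2] := digit_succ i s q0.
    apply: wp_comp; apply: wp_asgn.
      by rewrite /= Es Es1 It; case: (_ %| _) => /=; lia.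
    apply: wp_comp; apply: wp_store => //; first by rewrite /= Es; lia.
    apply: wp_asgn => //= ? ?; rewrite Es Es1 It Eq1; split=> [s' lts'|].
      rewrite [s' < s.+1]ltnS [s' <= s]leq_eqVlt.
      by case: (eqVneq s' s) => [->|ne] /=; [rewrite D1 | rewrite Ih].
    by rewrite D2.
  - move=> h1 _ [Ih It]; split=> // s lts; by rewrite Ih // lts.
rewrite /=; lia.
Qed.

Definition subgraph_code (x j i : nat) : seq nat :=
  [seq nat_of_bool (in_tuple_code q b i (edge_hash p k q x j e) == flip)
     | e <- iota 0 m] ++ [:: 2].

Definition collection_code : seq nat :=
  flatten (mkseq (fun x => flatten (mkseq (fun j =>
    flatten (mkseq (subgraph_code x j) (q ^ b))) l)) p).

Lemma flatten_mkseqS (F : nat -> seq nat) n :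
  flatten (mkseq F n.+1) = flatten (mkseq F n) ++ F n.
Proof. by rewrite /mkseq iota0S map_rcons flatten_rcons. Qed.

Lemma emit_collection_ok h :
  var h vm = m -> var h vb = b -> var h vk = k -> var h vp = p ->
  var h vq = q -> var h vl = l -> var h vflip = flip ->
  (forall j x, j < l -> x < p -> arr h 0 (j * p + x) = table q j x) ->
  wp W emit_collection
   (q * 60 + b * 60 + p * (l * (q ^ b * (m * (k * 120 + 200) + b * 220 + 300) + 100) + 100) + 200)
   (fun h' => outp h' = outp h ++ collection_code) h.
Proof.
move=> Em Eb Ek Ep Eq El Ef Et; apply: wp_le.
  apply: wp_comp; apply: wp_conseq; first by apply: (@fill_ok W D D_W q) => //; lia.
  move=> h1 f1 E1.
  apply: wp_comp; apply: wp_conseq.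
    by apply: (@fill_ok W D D_W b) => //; rewrite ?(frame_var f1) //; lia.
  move=> h2 f2 E2.
  have v2 z : z \notin vars_set (fill 4 vq 0) -> var h2 z = var h z.
    by move=> nz; rewrite (frame_var f2) // (frame_var f1).
  pose par h' := [/\ var h' vm = m, var h' vb = b, var h' vk = k, var h' vp = p
     & [/\ var h' vq = q, var h' vl = l, var h' vflip = flip
       & forall j x, j < l -> x < p -> arr h' 0 (j * p + x) = table q j x]].
  have P2 : par h2.
    rewrite /par !v2 //; do 2!split=> //; move=> j x ltj ltx.
    by rewrite (frame_arr f2) // (frame_arr f1) // Et.
  have O2 : outp h2 = outp h by rewrite (frame_out f2) // (frame_out f1).
  have parF s h3 h4 : all (fun z => z \notin vars_set s)
      [:: vm; vb; vk; vp; vq; vl; vflip] -> 0 \notin arrs_set s ->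
      frame s h3 h4 -> par h3 -> par h4.
    move=> /and5P[n1 n2 n3 n4 /and4P[n5 n6 n7 _]] na f.
    rewrite /par !(frame_var f) // => -[? ? ? ? [? ? ? H]]; do 2!split=> //.
    by move=> j x ltj ltx; rewrite (frame_arr f) // H.
  (* Restored after each pair [(x, j)]: the tuple counter overflows to zero and [mark 0] has erased
     every mark, so both arrays are filled only once. *)
  pose clean h' := (forall s, s < b -> arr h' 3 s = 0) /\
                   (forall v, v < q -> arr h' 4 v = 0).
  have C2 : clean h2 by split=> // v ltv; rewrite (frame_arr f2) // E1.
  clear f1 f2 E1 E2 v2.
  apply: (@wp_for _ p _ _ _ _ (fun x h' => clean h' /\ outp h' = outp h ++
     flatten (mkseq (fun x => flatten (mkseq (fun j =>
       flatten (mkseq (subgraph_code x j) (q ^ b))) l)) x))) => //; try lia.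
  - by case: P2.
  - by move=> ? ?; rewrite cats0.
  - move=> x h3 ltx f3 Ex [C3 O3].
    have P3 : par h3 by apply: parF f3 P2.
    apply: (@wp_for _ l _ _ _ _ (fun j h' => clean h' /\ outp h' = outp h3 ++
        flatten (mkseq (fun j => flatten (mkseq (subgraph_code x j) (q ^ b))) j))) => //; try lia.
    + by case: P3 => _ _ _ _ [].
    + by move=> ? ?; rewrite cats0.
    + move=> j h4 ltj f4 Ej [C4 O4].
      have P4 : par h4 by apply: parF f4 P3.
      have Ex4 : var h4 vx = x by rewrite (frame_var f4).
      apply: wp_comp; apply: wp_asgn; first by rewrite /=; lia.
      apply: (@wp_while _ (q ^ b) _ _ _ (fun i h' => [/\
         forall s, s < b -> arr h' 3 s = digit q i s,
         forall v, v < q -> arr h' 4 v = 0,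
         var h' vgo = (i < q ^ b)
       & outp h' = outp h4 ++ flatten (mkseq (subgraph_code x j) i)])).
      * split=> /=; rewrite ?cats0 //; last by rewrite expn_gt0 q0.
          by move=> s lts; rewrite (proj1 C4) // /digit div0n mod0n.
        exact: (proj2 C4).
      * move=> i h5 lti f5 [Ed Ez Eg O5]; rewrite Eg lti; split=> //.
        have P5 : par h5 by apply: parF f5 _.
        have Ex5 : var h5 vx = x by rewrite (frame_var f5).
        have Ej5 : var h5 vj = j by rewrite (frame_var f5).
        have d_lt s : s < b -> digit q i s < q by rewrite ltn_pmod.
        apply: wp_comp; apply: wp_conseq.
          by apply: mark_ok Ed d_lt _; first by case: P5.
        move=> h6 f6 E6; have P6 : par h6 by apply: parF f6 P5.
        have E6' v : v < q -> arr h6 4 v = in_tuple_code q b i v.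
          by move=> ltv; rewrite E6 Ez // -/(in_tuple_code q b i v); case: in_tuple_code.
        case: (P6) => Em6 Eb6 Ek6 Ep6 [Eq6 El6 Ef6 Et6].
        apply: wp_comp; apply: wp_conseq.
          apply: (@emit_edges_ok (in_tuple_code q b i) x j) => //.
          - by rewrite (frame_var f6).
          - by rewrite (frame_var f6).
          - by move=> y; apply: Et6.
        move=> h7 f7 O7; have P7 : par h7 by apply: parF f7 P6.
        apply: wp_comp; apply: wp_out; first by rewrite /=; lia.
        apply: wp_comp; apply: wp_conseq.
          apply: (@mark_ok 0 (digit q i)) => //.
          - by case: P7.
          - by move=> s lts; rewrite /= (frame_arr f7) // (frame_arr f6) // Ed.
        move=> h8 f8 E8; have P8 : par h8 by apply: parF f8 _.
        apply: wp_comp; apply: wp_conseq.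
          apply: (@next_tuple_ok i).
          - by case: P8.
          - by case: P8 => _ _ _ _ [].
          - move=> s lts; rewrite (frame_arr f8) //= (frame_arr f7) //.
            by rewrite (frame_arr f6) // Ed.
        move=> h9 f9 [E9 Et9]; apply: wp_asgn; first by rewrite /=; lia.
        split=> //.
        - move=> v ltv; rewrite /= (frame_arr f9) // E8 /= (frame_arr f7) // E6.
          by case: has => //; rewrite Ez.
        - rewrite /= Et9; have q0b : 0 < q ^ b by rewrite expn_gt0 q0.
          case: (ltngtP i.+1 (q ^ b)) lti => [lt1|//|->] _; last by rewrite dvdnn.
          by rewrite gtnNdvd.
        - rewrite flatten_mkseqS /subgraph_code /= (frame_out f9) // (frame_out f8) //=.
          by rewrite O7 (frame_out f6) // O5 rcons_cat catA -cats1 -!catA.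
      * move=> h5 f5 [Ed Ez Eg O5]; rewrite Eg ltnn; split=> // ? ?; split.
          by split=> //= s lts; rewrite Ed // digit_expn.
        by rewrite flatten_mkseqS /= O5 O4 catA.
    + move=> h4 f4 [C4 O4] ? ?; split=> //.
      by rewrite flatten_mkseqS /= O4 O3 catA.
  - by move=> h3 _ [].
rewrite /=; nia.
Qed.

End Output.

(** * Size and running time *)

Section Bounds.
Variables m L f k p b : nat.
Let B := 2 * (L * f).
Let lam := up_log 2 p.
Let g := greedy_mode L f lam k b.
Let q := if g then 4 * B else p.
Let l := if g then 4 * B * lam else 1.

Hypotheses (L0 : 0 < L) (f0 : 0 < f) (k0 : 0 < k).
Hypothesis le_m : m <= (k * B) ^ k.
Hypothesis min_k : forall k', 0 < k' < k -> (k' * B) ^ k' < m.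
Hypotheses (pp : prime p) (le_kBp : k * B <= p).
Hypothesis min_p : forall p', k * B <= p' < p -> ~~ prime p'.

Let s0 : 0 < L * f. Proof. by rewrite muln_gt0 L0. Qed.
Let B1 : 1 < B. Proof. by rewrite /B; lia. Qed.
Let p1 : 1 < p. Proof. exact: prime_gt1. Qed.
Let lam0 : 0 < lam. Proof. by rewrite up_log_gt0. Qed.

Lemma prime_le : p <= 4 ^ 6 * (k * B).
Proof.
have kB0 : 0 < k * B by rewrite muln_gt0 k0; lia.
have [p' pp' /andP[le_kp' le_p']] := prime_between kB0.
rewrite leqNgt; apply/negP => lt_p.
by have := min_p (p' := p'); rewrite pp' le_kp' (leq_ltn_trans le_p' lt_p) => /(_ isT).
Qed.

Lemma degree_le c : 0 < c -> m <= (c * B) ^ c -> k <= c.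
Proof.
move=> c0 le_mc; rewrite leqNgt; apply/negP => lt_ck.
by have := min_k (k' := c); rewrite c0 lt_ck ltnNge le_mc => /(_ isT).
Qed.

Lemma degree_le_pow a c : a <= B -> 0 < c -> m <= a ^ c -> k <= c.
Proof.
move=> le_aB c0 le_ma; apply: degree_le => //; apply: leq_trans le_ma _.
by rewrite leq_exp2r // (leq_trans le_aB) // leq_pmull.
Qed.

Lemma degree_le_log : 1 < m -> k <= up_log 2 m.
Proof.
move=> m1; apply: (@degree_le_pow 2) => //; first by rewrite up_log_gt0.
exact: up_logP.
Qed.

Lemma q_gt0 : 0 < q.
Proof. by rewrite /q; case: ifP => _; lia. Qed.

Lemma l_gt0 : 0 < l.
Proof. by rewrite /l; case: ifP => _ //; rewrite !muln_gt0 lam0 andbT; lia. Qed.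

Lemma l_le : l <= q * lam.
Proof. by rewrite /l /q; case: ifP => _ //; rewrite muln_gt0 lam0 andbT ltnW. Qed.

Lemma B_le_q : B <= q.
Proof.
rewrite /q; case: ifP => _; first lia.
by apply: leq_trans le_kBp; rewrite leq_pmull.
Qed.

(** Even when the alphabet is reduced, [p] exceeds [q] by at most a factor [O(k)]; this is what pays
    for the terms quadratic in [p] when the table is computed. *)
Lemma prime_le_q : p <= 4 ^ 6 * k * q.
Proof.
apply: leq_trans prime_le _; rewrite -mulnA leq_mul2l; apply/orP; right.
by rewrite leq_mul2l B_le_q orbT.
Qed.

Lemma collisions_bound u v : u < p -> v < p -> u != v ->
  collisions q l u v <= (if g then 4 * lam else 0).
Proof.
move=> lt_u lt_v ne; rewrite /q /l; case: ifP => _.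
  by apply: (@collisions_le _ p) => //; [lia | rewrite up_logP].
rewrite /collisions big_nat1 leqn0 eqb0; apply: contra ne => /eqP E.
by apply/eqP/esym/(table0_inj (leqnn p)) => //.
Qed.

(** In greedy mode each level uses half of [p * l]: [2 L f (k - 1) < p] because [p >= 2 k L f], and
    [L f * 4 lam] is exactly [l / 2]. In direct mode only the first inequality is involved. *)
Lemma covering_slack x y : x <= L -> y <= f ->
  x * y * (k.-1 * l + p * (if g then 4 * lam else 0)) < p * l.
Proof.
move=> le_x le_y; have le_xy : x * y <= L * f by apply: leq_mul.
apply: leq_ltn_trans (leq_mul le_xy (leqnn _)) _.
have lt_p : 2 * (L * f) * k.-1 < p.
  apply: leq_trans le_kBp; rewrite /B; move: s0.
  by case: (k) k0 => // j _ /=; move: (L * f) => s; nia.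
rewrite /l; case: ifP => _; last first.
  by rewrite !muln1 muln0 addn0; lia.
move: s0 lam0 lt_p; rewrite /B; move: (L * f) lam k.-1 => s u j s1 u1 ltp.
have -> : s * (j * (4 * (2 * s) * u) + p * (4 * u)) =
  4 * s * u * (2 * s * j) + 4 * s * u * p by lia.
have -> : p * (4 * (2 * s) * u) = 4 * s * u * p + 4 * s * u * p by lia.
by rewrite ltn_add2r ltn_pmul2l // !muln_gt0 s1 u1.
Qed.

Definition CV_const : nat := 2 * 4 ^ 6.

Let p_le_s : p <= CV_const * k * (L * f).
Proof. by apply: leq_trans prime_le _; rewrite /B /CV_const; nia. Qed.

(** Write [s = L f]. Direct mode is [p ^ b.+1] with [p = O(k s)]. In greedy mode the product is
    [O(k) * (8 s) ^ b.+1 * (s * lam)], and the mode condition replaces [s * lam] by [k ^ b]. *)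
Lemma CV_le_degree : p * l * q ^ b <= (8 * CV_const * k * L * f) ^ b.+1.
Proof.
have CC : 0 < CV_const by rewrite /CV_const.
have -> : 8 * CV_const * k * L * f = 8 * (L * f) * k * CV_const by lia.
rewrite -[p * l * _]mulnA.
rewrite /l /q; case: ifP => [|_]; rewrite ?/g ?/greedy_mode.
  rewrite /B; move: p_le_s s0; move: (L * f) => s le_p s1 le_s.
  rewrite (expnMn (8 * s * k)) (expnMn (8 * s)) (_ : 4 * (2 * s) = 8 * s); last lia.
  apply: leq_trans (leq_mul le_p (leqnn _)) _.
  rewrite (_ : CV_const * k * s * (8 * s * lam * (8 * s) ^ b) =
    CV_const * k * (8 * s) ^ b.+1 * (s * lam)); last by rewrite expnS; lia.
  apply: leq_trans (leq_mul (leqnn _) le_s) _.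
  rewrite (_ : CV_const * k * (8 * s) ^ b.+1 * k ^ b =
    (8 * s) ^ b.+1 * k ^ b.+1 * CV_const); last by rewrite [k ^ b.+1]expnS; lia.
  by rewrite leq_mul // expnS leq_pmulr // expn_gt0 CC.
rewrite mul1n -expnS leq_exp2r //.
apply: leq_trans p_le_s _; lia.
Qed.

Hypotheses (Lm : L <= m.+1) (fm : f <= m.+1).

(** By minimality [((k - 1) B) ^ (k - 1) < m], while [p = O((k - 1) B)] for [k >= 2]; taking
    logarithms gives the claim. For [k = 1] the caps on [L] and [f] give [p = O(m ^ 2)]. *)
Lemma degree_log_le : 1 < m -> k * lam <= 30 * up_log 2 m.
Proof.
move=> m1; set u := up_log 2 m; have u0 : 0 < u by rewrite up_log_gt0.
have lam_le x : p <= 2 ^ x -> lam <= x by apply: up_log_min.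
have p_le := prime_le; have le_2u : m <= 2 ^ u by apply: up_logP.
have E4 : 4 ^ 6 = 2 ^ 12 by rewrite pow4.
case: (leqP k 1) => [k1|k2].
  have Ek : k = 1 by lia.
  rewrite Ek mul1n; apply: leq_trans (_ : 15 + 2 * u <= _); last lia.
  apply: lam_le; apply: leq_trans p_le _.
  rewrite Ek mul1n E4 (_ : 15 + 2 * u = 12 + (3 + 2 * u)) // expnD leq_mul2l /=.
  rewrite expnD mulnC [2 * u]mulnC expnM /B.
  have : L * f <= (2 * 2 ^ u) * (2 * 2 ^ u) by apply: leq_mul; lia.
  by rewrite -[2 ^ 3]/8; move: (2 ^ u) (L * f) => z s; lia.
pose j := k.-1; have j0 : 0 < j by rewrite /j; lia.
have lt_m : (j * B) ^ j < m by apply: min_k; rewrite /j; lia.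
have y1 : 1 < j * B by rewrite (leq_trans B1) // leq_pmull.
set y := j * B in lt_m y1; pose t := trunc_log 2 y.
have t0 : 0 < t by rewrite trunc_log_gt0.
have le_jt : j * t <= u.
  rewrite -(@leq_exp2l 2) // mulnC expnM; apply: leq_trans le_2u.
  apply: leq_trans (ltnW lt_m); rewrite leq_exp2r //.
  by apply: trunc_logP => //; apply: ltnW.
have le_lam : lam <= 14 + t.
  apply: lam_le; apply: leq_trans p_le _.
  have lt_y : y < 2 ^ t.+1 by apply: trunc_log_ltn.
  have le_kB : k * B <= 2 * y.
    by rewrite /y mulnA leq_mul2r; apply/orP; right; rewrite /j; lia.
  rewrite E4 (_ : 14 + t = 12 + (1 + t.+1)); last lia.
  rewrite expnD leq_mul2l /= expnD expn1; apply: leq_trans le_kB _.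
  by rewrite leq_mul2l ltnW.
have -> : k = j.+1 by rewrite /j; lia.
(* Here [(j + 1) (14 + t) = 14 j + j t + 14 + t] with [j], [t] and [j t] at most [u] and [u >= 1]:
   this is the 30. *)
apply: leq_trans (leq_mul (leqnn _) le_lam) _.
have le_j : j <= u by apply: leq_trans le_jt; rewrite leq_pmulr.
nia.
Qed.

(** In greedy mode [k * lam] appears as a factor. In direct mode one [k] of [k ^ b.+1] is set aside
    and the rest satisfies [k ^ b < L f lam], so [k * lam] appears again, with one more factor
    [L f]. *)
Lemma CV_le_log : 1 < m ->
  p * l * q ^ b <= (240 * CV_const * L * f) ^ b.+2 * up_log 2 m.
Proof.
move=> m1; have kl := degree_log_le m1.
have CC : 0 < CV_const by rewrite /CV_const.
have -> : 240 * CV_const * L * f = 30 * (8 * (L * f) * CV_const) by lia.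
rewrite -[p * l * _]mulnA [in leqRHS]expnMn.
have le30 : 30 <= 30 ^ b.+2 by rewrite -{1}(expn1 30) leq_exp2l.
apply: leq_trans (_ : (8 * (L * f) * CV_const) ^ b.+2 * (30 * up_log 2 m) <= _); last first.
  by rewrite mulnA leq_mul2r mulnC leq_mul2r le30 !orbT.
apply: leq_trans (leq_mul (leqnn _) kl).
rewrite /l /q; case: ifP => [_|/negbT]; rewrite ?/g ?/greedy_mode -?ltnNge.
  rewrite /B; move: p_le_s s0; move: (L * f) => s le_p s1.
  rewrite (_ : 4 * (2 * s) = 8 * s); last lia.
  apply: leq_trans (leq_mul le_p (leqnn _)) _.
  rewrite (_ : CV_const * k * s * (8 * s * lam * (8 * s) ^ b) =
    s * CV_const * (8 * s) ^ b.+1 * (k * lam)); last by rewrite expnS; lia.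
  rewrite leq_mul2r; apply/orP; right; rewrite [leqRHS]expnS; apply: leq_mul; first lia.
  by rewrite leq_exp2r // leq_pmulr.
move=> lt_kb; rewrite mul1n -expnS.
apply: leq_trans (_ : (CV_const * (L * f)) ^ b.+1 * (k * (L * f * lam)) <= _).
  apply: leq_trans (_ : (CV_const * k * (L * f)) ^ b.+1 <= _).
    by rewrite leq_exp2r.
  rewrite (_ : CV_const * k * (L * f) = CV_const * (L * f) * k); last lia.
  by rewrite expnMn leq_mul2l [k ^ _]expnS leq_mul2l (ltnW lt_kb) !orbT.
rewrite (_ : k * (L * f * lam) = L * f * (k * lam)); last lia.
rewrite mulnA leq_mul2r; apply/orP; right.
rewrite [leqRHS]expnSr; apply: leq_mul; last by move: (L * f) => s; nia.
by rewrite leq_exp2r //; move: (L * f) => s; nia.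
Qed.

Hypotheses (b0 : 0 < b) (bm : b <= m.+1).

(** Literally the sum that [wp_comp] assembles along [rpc_program]. *)
Definition time_bound : nat :=
  (200 + (k * (k * 80 + 200) + 20 + ((p - k * B).+1 * (p * 80 + 100) + 40 +
  (p * 100 + 60 + (b * 80 + 200 +
  (p * p * 60 + l * p * (q * 140 + p * 350 + 400) + l * 100 + 100 +
  (q * 60 + b * 60 + p * (l * (q ^ b * (m * (k * 120 + 200) + b * 220 + 300) + 100)
     + 100) + 200)).+1).+1).+1).+1).+1).+1.

Definition time_const : nat := 500 * 4 ^ 6 + 4900.

Lemma time_bound_le : 0 < m ->
  time_bound <= time_const * m * k * (p * l * q ^ b).
Proof.
move=> m0; set V := p * l * q ^ b; set X := m * k * V.
have c1 : 0 < 4 ^ 6 by rewrite expn_gt0.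
have qb : q <= q ^ b by rewrite -{1}(expn1 q) leq_pexp2l // q_gt0.
have VX : V * (m * k) = X by rewrite /X mulnC.
have lplq : p * l * q <= V by rewrite /V leq_mul2l qb orbT.
have VltX : V <= X by rewrite /X leq_pmull // muln_gt0 m0.
have kV : k * V <= X by rewrite /X -mulnA leq_pmull.
have mV : m * V <= X by rewrite /X mulnAC leq_pmulr.
have := prime_le_q; have := q_gt0; have := l_gt0.
rewrite /time_bound /time_const; move: (4 ^ 6) c1 => c c1.
rewrite -/V => l0 q0' le_pq.
have lp : l * p <= V by rewrite /V mulnC leq_pmulr // expn_gt0 q0'.
have p_V : p <= V by apply: leq_trans lp; rewrite leq_pmull.
have l_V : l <= V by apply: leq_trans lp; rewrite leq_pmulr // ltnW.
have q_V : q <= V.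
  by apply: leq_trans lplq; rewrite leq_pmull // muln_gt0 l0 (ltnW p1).
have lpq : l * p * q <= V by rewrite [l * p]mulnC.
(* Weights cost [p] steps per table entry; [p <= c k q] trades one [p] for [c k q], and [l p q <= V]
   because [b >= 1]. *)
have lpp : l * p * p <= c * X.
  apply: leq_trans (leq_mul (leqnn (l * p)) le_pq) _.
  rewrite (_ : l * p * (c * k * q) = c * (k * (l * p * q))); last lia.
  by rewrite leq_mul2l (leq_trans _ kV) ?orbT // leq_mul2l lpq orbT.
have pp' : p * p <= c * X.
  by apply: leq_trans lpp; rewrite -mulnA leq_pmull.
have k_p : k <= p by apply: leq_trans le_kBp; rewrite leq_pmulr //; lia.
have kk : k * k <= X by apply: leq_trans kV; rewrite leq_mul2l (leq_trans k_p p_V) orbT.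
have pk : (p - k * B).+1 * (p * 80 + 100) <= 80 * (p * p) + 180 * p + 100.
  apply: leq_trans (leq_mul (_ : _ <= p.+1) (leqnn _)) _; first by rewrite ltnS leq_subr.
  lia.
have V0 : 0 < V by apply: leq_trans p_V; apply: ltnW.
have b2m : b <= 2 * m by lia.
have bV : b * V <= 2 * X.
  by apply: leq_trans (leq_mul b2m (leqnn V)) _; rewrite -mulnA leq_mul2l mV orbT.
have b_X : b <= 2 * X.
  by apply: leq_trans bV; rewrite leq_pmulr.
have main : p * (l * (q ^ b * (m * (k * 120 + 200) + b * 220 + 300) + 100) + 100)
   = 120 * X + 200 * (m * V) + 220 * (b * V) + 300 * V + 100 * (l * p) + 100 * p.
  by rewrite /X /V; move: (q ^ b) => z; lia.
rewrite main; have -> : (500 * c + 4900) * m * k * V = 500 * (c * X) + 4900 * X by rewrite /X; lia.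
have X0 : 0 < X by apply: leq_trans VltX.
have cX : X <= c * X by rewrite leq_pmull.
have e1 : k * (k * 80 + 200) = 80 * (k * k) + 200 * k by lia.
have e2 : l * p * (q * 140 + p * 350 + 400) = 140 * (l * p * q) + 350 * (l * p * p) + 400 * (l * p) by lia.
rewrite e1 e2.
move: (l * p * q) (l * p * p) (l * p) (p * p) (k * k) (c * X) (b * V) (m * V)
  ((p - k * B).+1 * _) lpq lpp lp pp' kk bV mV pk cX.
lia.
Qed.

End Bounds.

(** * The algorithm *)

Definition rpc_program : stmt :=
  (read_params ;; find_degree ;; find_prime ;; find_log ;; choose_mode ;;
   fill_table ;; emit_collection)%P.

Definition rpc_algorithm : algorithm := Algorithm (stmt_code rpc_program) 100.

Section Collection.
Variables p q l k b m : nat.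
Variable flip : bool.

Definition subgraph (x j i : nat) : {set 'I_m} :=
  [set e : 'I_m | in_tuple_code q b i (edge_hash p k q x j e) == flip].

Definition collection : seq {set 'I_m} :=
  flatten (mkseq (fun x => flatten (mkseq (fun j =>
    mkseq (subgraph x j) (q ^ b)) l)) p).

Lemma encode_collection_flatten (ss : seq (seq {set 'I_m})) :
  encode_collection (flatten ss) = flatten [seq encode_collection s | s <- ss].
Proof.
by elim: ss => //= s ss <-; rewrite /encode_collection map_cat flatten_cat.
Qed.

Lemma encode_collectionE :
  encode_collection collection = collection_code p q l k b m flip.
Proof.
rewrite encode_collection_flatten /mkseq -map_comp; congr flatten.
apply: eq_map => x /=; rewrite encode_collection_flatten /mkseq -map_comp.
congr flatten; apply: eq_map => j /=; rewrite /encode_collection -map_comp.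
congr flatten; apply: eq_map => i /=; rewrite /encode_subgraph /subgraph_code.
rewrite cats1; congr rcons; rewrite -val_enum_ord -map_comp.
by apply: eq_map => e /=; rewrite inE.
Qed.

Lemma size_flatten_mkseq (T : Type) (F : nat -> seq T) n c :
  (forall i, size (F i) = c) -> size (flatten (mkseq F n)) = n * c.
Proof.
move=> sF; elim: n => // n IHn.
by rewrite /mkseq iota0S map_rcons flatten_rcons size_cat IHn sF mulSn addnC.
Qed.

Lemma size_collection : size collection = p * l * q ^ b.
Proof.
rewrite -mulnA; apply: size_flatten_mkseq => x.
by apply: size_flatten_mkseq => j; rewrite size_mkseq.
Qed.

Lemma mem_collection x j i :
  x < p -> j < l -> i < q ^ b -> subgraph x j i \in collection.
Proof.
move=> ltx ltj lti; apply/flatten_mapP; exists x; first by rewrite mem_iota.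
apply/flatten_mapP; exists j; first by rewrite mem_iota.
by apply/mapP; exists i; rewrite ?mem_iota.
Qed.

End Collection.

Lemma word_gt d W : 0 < d -> 5 * d + 5 <= W -> d < W /\ 5 < W.
Proof. lia. Qed.

Lemma word_fit u d : 2 ^ 4 <= u -> 0 < d -> 5 * d + 5 <= u * d.
Proof. by rewrite -[2 ^ 4]/16; nia. Qed.

(** * Correctness of the collection and of the program *)

Section Main.
Variables (m : nat) (G : wgraph m) (L f k p : nat).
Let L' := minn L m.+1.
Let f' := minn f m.+1.
Let b := minn L' f'.
Let B := 2 * (L' * f').
Let lam := up_log 2 p.
Let g := greedy_mode L' f' lam k b.
Let q := if g then 4 * B else p.
Let l := if g then 4 * B * lam else 1.
Let flip := L' < f'.

Hypotheses (L0 : 0 < L) (f0 : 0 < f) (k0 : 0 < k).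
Hypothesis le_m : m <= (k * B) ^ k.
Hypothesis min_k : forall k', 0 < k' < k -> (k' * B) ^ k' < m.
Hypotheses (pp : prime p) (le_kBp : k * B <= p).
Hypothesis min_p : forall p', k * B <= p' < p -> ~~ prime p'.

Let L'0 : 0 < L'. Proof. by rewrite leq_min L0. Qed.
Let f'0 : 0 < f'. Proof. by rewrite leq_min f0. Qed.
Let b0 : 0 < b. Proof. by rewrite leq_min L'0. Qed.
Let L'm : L' <= m.+1. Proof. exact: geq_minr. Qed.
Let f'm : f' <= m.+1. Proof. exact: geq_minr. Qed.
Let bm : b <= m.+1. Proof. by rewrite (leq_trans (geq_minl _ _)). Qed.
Let p1 : 1 < p. Proof. exact: prime_gt1. Qed.
Let q0 : 0 < q. Proof. exact: (q_gt0 b L'0 f'0 k0 le_m). Qed.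

(** Any given short replacement path is itself covered: it has at most [L] edges, all outside [F],
    and the separation of these two sets is a statement about edge numbers. *)
Lemma collection_is_RPC : is_RPC G L f (collection p q l k b m flip).
Proof.
move=> s t F le_F [path rep le_path]; exists path; split=> //.
pose P := [set e in unzip1 path].
have le_P : #|P| <= L'.
  rewrite leq_min; apply/andP; split.
    by rewrite cardsE (leq_trans (card_size _)) // size_map.
  by rewrite (leq_trans (max_card _)) // card_ord.
have le_F' : #|F| <= f'.
  by rewrite leq_min le_F (leq_trans (max_card _)) // card_ord.
have disPF : [disjoint P & F].
  case: rep => /and4P[_ _ _ /allP notF] _.
  by apply/pred0P => e /=; rewrite inE; case: (boolP (e \in unzip1 path)) => //= /notF/negbTE.
have le_q : B <= q := B_le_q b L'0 f'0 k0 le_m pp le_kBp.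
have lt_q : L' < q /\ f' < q.
  have le_L : L' * 1 <= L' * f' by rewrite leq_mul2l f'0 orbT.
  have le_f : 1 * f' <= L' * f' by rewrite leq_mul2r L'0 orbT.
  by move: le_q le_L le_f L'0 f'0; rewrite /B muln1 mul1n; lia.
have le_mp : m <= p ^ k by rewrite (leq_trans le_m) // leq_exp2r.
have cov := covering_slack b L'0 f'0 k0 le_m pp le_kBp le_P le_F'.
have coll := collisions_bound b L'0 f'0 k0 le_m pp le_kBp.
have [x [j [ltx ltj sep]]] := separating_hash pp le_mp coll disPF cov.
rewrite /covers -/flip; case E : flip.
  have [||i lti [inP outF]] := tuple_code_separates
    q0 (b := b)
    (fun e : 'I_m => edge_hash_lt p k q0 x j e) _ _ sep.
  - by rewrite leq_min le_P (leq_trans le_P) // ltnW.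
  - exact: leq_ltn_trans le_F' lt_q.2.
  exists (subgraph p q k b m true x j i); first exact: mem_collection.
  apply/andP; split.
    by apply/allP => e eP; rewrite inE inP // inE.
  by apply/pred0P => e /=; rewrite inE; case: (boolP (e \in F)) => //= /outF/negbTE->.
(* The roles are exchanged when [f' <= L'], so that the smaller set is always the guessed one. *)
have sep' e e' : e \in F -> e' \in P -> edge_hash p k q x j e != edge_hash p k q x j e'.
  by move=> eF e'P; rewrite eq_sym sep.
have [||i lti [inF outP]] := tuple_code_separates
    q0 (b := b)
    (fun e : 'I_m => edge_hash_lt p k q0 x j e) _ _ sep'.
- by rewrite leq_min le_F' andbT (leq_trans le_F') // leqNgt -/flip E.
- exact: leq_ltn_trans le_P lt_q.1.
exists (subgraph p q k b m false x j i); first exact: mem_collection.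
apply/andP; split.
  by apply/allP => e eP; rewrite inE eqbF_neg outP // inE.
by apply/pred0P => e /=; rewrite inE; case: (boolP (e \in F)) => //= /inF->.
Qed.

Let n := m.+2.
(** As [n >= 2], constants too are powers of [n]. The exponent is that of the largest quantity, the
    weight bound [2 * (p ^ 2 * 4 ^ lam)], counted as 1 + 32 + 34 with [p <= n ^ 16]. *)
Let D := n ^ 67.

Let leD x a : x <= n ^ a -> a <= 67 -> x <= D.
Proof. by move=> le_x le_a; rewrite (leq_trans le_x) // leq_pexp2l. Qed.

Let leM x y a c : x <= n ^ a -> y <= n ^ c -> x * y <= n ^ (a + c).
Proof. by move=> le_x le_y; rewrite expnD leq_mul. Qed.

Let le_const a : 2 ^ a <= n ^ a.
Proof. by case: a => // a; rewrite leq_exp2r. Qed.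

Let L'n : L' <= n ^ 1. Proof. by rewrite expn1 (leq_trans L'm). Qed.
Let f'n : f' <= n ^ 1. Proof. by rewrite expn1 (leq_trans f'm). Qed.
Let Bn : B <= n ^ 3. Proof. exact: leM (le_const 1) (leM L'n f'n). Qed.

Let kn : k <= n ^ 1.
Proof.
rewrite expn1 ltnW // ltnS; apply: (degree_le_pow min_k (a := 2)) => //.
  by rewrite -[2]muln1 leq_mul2l /= muln_gt0 L'0.
by rewrite ltnW // (leq_trans (ltn_expl m (isT : 1 < 2))) // leq_exp2l.
Qed.

Let pn : p <= n ^ 16.
Proof.
apply: leq_trans (prime_le b L'0 f'0 k0 le_m pp le_kBp min_p) _.
have -> : 4 ^ 6 = 2 ^ 12 by rewrite pow4.
exact: leM (le_const 12) (leM kn Bn).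
Qed.

Let lamp : lam <= p.
Proof. by rewrite up_log_min // ltnW // ltn_expl. Qed.

Let lamn : lam <= n ^ 16. Proof. exact: leq_trans lamp pn. Qed.

Let B4n : 4 * B <= n ^ 5. Proof. exact: leM (le_const 2) Bn. Qed.

Let qn : q <= n ^ 16.
Proof.
by rewrite /q; case: ifP => // _; rewrite (leq_trans B4n) // leq_pexp2l.
Qed.

Let ln : l <= n ^ 21.
Proof.
by rewrite /l; case: ifP => _; [exact: leM B4n lamn | rewrite expn_gt0].
Qed.

Let weight_n : 2 * (p ^ 2 * 4 ^ lam) <= D.
Proof.
have p2 : p ^ 2 <= n ^ 32 by exact: leM pn pn.
have E : 2 ^ lam <= 2 * p.
  have := up_log_gtn (isT : 1 < 2) p1; have := up_log_gt0 2 p.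
  rewrite p1 -/lam; case: (lam) => // a _ /= lt_p.
  by rewrite expnS leq_mul2l ltnW.
have l2 : 4 ^ lam <= n ^ 34.
  have -> : 4 ^ lam = 2 ^ lam * 2 ^ lam by rewrite -expnMn.
  by apply: leq_trans (leq_mul E E) _; apply: leM (leM (le_const 1) pn) (leM (le_const 1) pn).
by apply: leq_trans (leM (le_const 1) (leM p2 l2)) _.
Qed.

(** The arrays initially interleave the input, so [m], [L] and [f] stand in cell 0 of arrays 1, 2
    and 3. *)
Definition initial_hstate (inp : seq nat) : hstate :=
  HState (fun=> 0) (fun t i => nth 0 inp (5 * i + t)) [::].

Lemma rpc_program_ok W h :
  5 * D + 5 <= W ->
  arr h 1 0 = m -> arr h 2 0 = L -> arr h 3 0 = f ->
  wp W rpc_program (time_bound m L' f' k p b) (fun h' =>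
    outp h' = outp h ++ encode_collection (collection p q l k b m flip)) h.
Proof.
move=> D_W Em EL Ef.
have [DW W5] : D < W /\ 5 < W by apply: word_gt D_W; rewrite expn_gt0.
have lt x a : x <= n ^ a -> a <= 67 -> x < W.
  by move=> le_x le_a; apply: leq_ltn_trans (leD le_x le_a) DW.
have B0 : 0 < B by rewrite !muln_gt0 L'0.
have mn : m <= n ^ 1 by rewrite expn1 ltnW // ltnW.
have bn : b <= n ^ 1 by rewrite expn1 (leq_trans bm).
have s_n : L' * f' <= n ^ 2 by exact: leM L'n f'n.
have kBn : k * B <= n ^ 4 by exact: leM kn Bn.
have lpn : l * p <= n ^ 37 by exact: leM ln pn.
have ppn : p * p <= n ^ 32 by exact: leM pn pn.
rewrite /rpc_program; apply: wp_le.
  apply: wp_comp; apply: wp_conseq.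
    by apply: (@read_params_ok W W5 m L f) => //; [apply: (lt _ 1); rewrite ?expn1 | apply: lt Bn _].
  rewrite -/L' -/f' => h1 f1 [m1 [L1 F1] b1 fl1 B1].
  apply: wp_comp; apply: wp_conseq.
    apply: (@find_degree_ok W W5 m B k) => //.
    - exact: lt kn _.
    - exact: lt kBn _.
    - exact: lt (leM mn kBn) _.
  move=> h2 f2 [k2 u2].
  apply: wp_comp; apply: wp_conseq.
    apply: (@find_prime_ok W W5 (k * B) p) => //.
    - by rewrite (leq_trans _ (leq_pmull _ k0)) // -[2]muln1 leq_mul2l muln_gt0 L'0.
    - apply: (lt _ 17); last by [].
      rewrite (@leq_trans (p * 2)) //; first by rewrite muln2 -addnn; lia.
      exact: leM pn (le_const 1).
  move=> h3 f3 p3.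
  apply: wp_comp; apply: wp_conseq.
    by apply: (@find_log_ok W W5 p) => //; apply: lt (leM pn (le_const 1)) _.
  move=> h4 f4 lam4.
  apply: wp_comp; apply: wp_conseq.
    apply: (@choose_mode_ok W W5 L' f' B b k p lam) => //.
    - by rewrite (frame_var f4) // (frame_var f3) // (frame_var f2).
    - by rewrite (frame_var f4) // (frame_var f3) // (frame_var f2).
    - by rewrite (frame_var f4) // (frame_var f3) // (frame_var f2).
    - by rewrite (frame_var f4) // (frame_var f3).
    - by rewrite (frame_var f4).
    - by rewrite (frame_var f4) // (frame_var f3) // (frame_var f2).
    - exact: lt s_n _.
    - exact: lt (leM (leM s_n lamn) kn) _.
    - exact: lt bn _.
    - exact: lt B4n _.
    - exact: lt (leM B4n lamn) _.
  rewrite -/g -/q -/l => h5 f5 [q5 l5].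
  have m5 : var h5 vm = m.
    by rewrite (frame_var f5) // (frame_var f4) // (frame_var f3) // (frame_var f2).
  have b5 : var h5 vb = b.
    by rewrite (frame_var f5) // (frame_var f4) // (frame_var f3) // (frame_var f2).
  have fl5 : var h5 vflip = flip.
    by rewrite (frame_var f5) // (frame_var f4) // (frame_var f3) // (frame_var f2).
  have k5 : var h5 vk = k.
    by rewrite (frame_var f5) // (frame_var f4) // (frame_var f3).
  have p5 : var h5 vp = p by rewrite (frame_var f5) // (frame_var f4).
  apply: wp_comp; apply: wp_conseq.
    apply: (@fill_table_ok W D D_W p q l lam) => //.
    - exact: l_le.
    - exact: leD lpn _.
    - exact: leD ppn _.
    - exact: leD qn _.
  move=> h6 f6 t6; apply: wp_conseq.
    apply: (@emit_collection_ok W D D_W p q l k b m flip) => //.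
    - exact: leD lpn _.
    - exact: leD ppn _.
    - exact: leD qn _.
    - exact: leD kn _.
    - exact: leD bn _.
    - exact: leD mn _.
    - by rewrite (frame_var f6).
    - by rewrite (frame_var f6).
    - by rewrite (frame_var f6).
    - by rewrite (frame_var f6).
    - by rewrite (frame_var f6).
    - by rewrite (frame_var f6).
    - by rewrite (frame_var f6).
  move=> h7 f7 ->; rewrite encode_collectionE; congr (_ ++ _).
  by rewrite (frame_out f6) // (frame_out f5) // (frame_out f4) // (frame_out f3) //
    (frame_out f2) // (frame_out f1).
exact: leqnn.
Qed.

Lemma rpc_algorithm_computes : exists2 T,
  computes rpc_algorithm G L f T (collection p q l k b m flip)
  & T <= time_bound m L' f' k p b.
Proof.
set inp := encode_input G L f; set W := word_bound 100 inp.
pose N := (size inp + \max_(x <- inp) x).+2.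
have le_inp x : x \in inp -> x <= \max_(x <- inp) x.
  by move=> x_inp; apply: (@leq_bigmax_seq _ inp xpredT (fun x => x)).
have le_nN : n <= N.
  rewrite /n /N !ltnS (leq_trans _ (leq_addl _ _)) // le_inp //.
  by rewrite /inp /encode_input !inE eqxx orbT.
have D_W : 5 * D + 5 <= W.
  apply: leq_trans (_ : n ^ 71 <= _).
    have -> : n ^ 71 = n ^ 4 * D by rewrite /D -expnD.
    by apply: word_fit; [exact: (le_const 4) | rewrite expn_gt0].
  apply: leq_trans (_ : n ^ 100 <= _); first by rewrite leq_pexp2l.
  by rewrite /W /word_bound -/N leq_exp2r.
have [_ W5] : D < W /\ 5 < W by apply: word_gt D_W; rewrite expn_gt0.
have W0 : 0 < W by apply: ltn_trans W5.
have memW a : nth 0 inp a < W.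
  case: (ltnP a (size inp)) => lt_a; last by rewrite nth_default.
  have := le_inp _ (mem_nth 0 lt_a); rewrite /W /word_bound -/N => le_x.
  apply: leq_trans (_ : N ^ 1 <= _); last by rewrite leq_pexp2l.
  by rewrite expn1 /N ltnS (leq_trans le_x) // leqW // leq_addl.
have [T [h' [le_T bs out_h']]] :=
  @rpc_program_ok W (initial_hstate inp) D_W erefl erefl erefl.
have rep : represents W (initial_hstate inp) (init_state inp).
  by split.
have [st' runs_st rep'] := stmt_code_runs W5 bs rep isT.
exists T => //; exists st'; first exact: runs_st [::].
by rewrite (rep_out rep') out_h'.
Qed.

End Main.

(** * Asymptotics *)

(** The degree [k] stays visible because the bounds differ in what is known of it: at most [c], or
    at most [up_log 2 m]. *)
Lemma rpc_algorithm_spec m (G : wgraph m) L f : 0 < L -> 0 < f ->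
  exists T C k, [/\ computes rpc_algorithm G L f T C, is_RPC G L f C,
    forall c, 0 < c -> m <= maxn L f ^ c -> k <= c,
    CV C <= (8 * CV_const * k * L * f) ^ (minn L f).+1
  & [/\ 1 < m -> CV C <= (240 * CV_const * L * f) ^ (minn L f).+2 * up_log 2 m,
        1 < m -> k <= up_log 2 m
      & 0 < m -> T <= time_const * m * k * CV C]].
Proof.
move=> L0 f0; pose L' := minn L m.+1; pose f' := minn f m.+1.
pose B := 2 * (L' * f').
have L'0 : 0 < L' by rewrite leq_min L0.
have f'0 : 0 < f' by rewrite leq_min f0.
have B2 : 2 <= B by rewrite -[2]muln1 leq_mul2l /= muln_gt0 L'0.
have exk : exists k, (0 < k) && (m <= (k * B) ^ k).
  exists m.+1; rewrite /= (@leq_trans (2 ^ m.+1)) ?leq_exp2r //.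
    by rewrite ltnW // ltnW // ltn_expl.
  by rewrite (leq_trans B2) // leq_pmull.
case: (ex_minnP exk) => k /andP[k0 le_m] min_k.
have {}min_k k' : 0 < k' < k -> (k' * B) ^ k' < m.
  move=> /andP[k'0 lt_k']; rewrite ltnNge; apply/negP => le_m'.
  by have := min_k k'; rewrite k'0 le_m' leqNgt lt_k' => /(_ isT).
have exp : exists p, prime p && (k * B <= p).
  have [p le_p pp] := prime_above (k * B); exists p.
  by rewrite pp ltnW.
case: (ex_minnP exp) => p /andP[pp le_p] min_p.
have {}min_p p' : k * B <= p' < p -> ~~ prime p'.
  move=> /andP[le_p' lt_p']; apply/negP => pp'.
  by have := min_p p'; rewrite pp' le_p' leqNgt lt_p' => /(_ isT).
have L'm : L' <= m.+1 by apply: geq_minr.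
have f'm : f' <= m.+1 by apply: geq_minr.
have L'L : L' <= L by apply: geq_minl.
have f'f : f' <= f by apply: geq_minl.
have bb : minn L' f' <= minn L f.
  by rewrite leq_min (leq_trans (geq_minl _ _) L'L) (leq_trans (geq_minr _ _) f'f).
have [T comp le_T] := rpc_algorithm_computes G L0 f0 k0 le_m min_k pp le_p min_p.
exists T; eexists; exists k; split; [exact: comp| | | |].
- exact: collection_is_RPC.
- move=> c c0 le_mc; apply: (degree_le_pow min_k (a := maxn L' f')) => //.
    by rewrite geq_max /B; nia.
  (* Truncation keeps the hypothesis: if the maximum is cut, it becomes [m.+1], whose powers still
     exceed [m]. *)
  rewrite /L' /f' -minn_maxl; case: (leqP (maxn L f) m.+1) => // _.
  by rewrite (leq_trans (leqnSn m)) // -{1}(expn1 m.+1) leq_pexp2l.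
- rewrite /CV size_collection.
  have := CV_le_degree (minn L' f') L'0 f'0 k0 le_m pp le_p min_p.
  move/leq_trans; apply.
  apply: (@leq_trans ((8 * CV_const * k * L * f) ^ (minn L' f').+1)).
    by rewrite leq_exp2r // !leq_mul.
  by rewrite leq_pexp2l // !muln_gt0 k0 L0 f0.
split=> [m1|m1|m0].
- rewrite /CV size_collection.
  have := CV_le_log (minn L' f') L'0 f'0 k0 le_m min_k pp le_p min_p L'm f'm m1.
  move/leq_trans; apply; rewrite leq_mul2r; apply/orP; right.
  apply: (@leq_trans ((240 * CV_const * L * f) ^ (minn L' f').+2)).
    by rewrite leq_exp2r // !leq_mul.
  by rewrite leq_pexp2l // !muln_gt0 L0 f0.
- exact: (degree_le_log (minn L' f') L'0 f'0 k0 le_m min_k pp le_p m1).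
- apply: leq_trans le_T _; rewrite /CV size_collection.
  apply: time_bound_le => //; first by rewrite leq_min L'0.
  exact: leq_trans (geq_minl _ _) L'm.
Qed.

Local Open Scope classical_set_scope.
Local Open Scope ring_scope.

Section Reals.
Variable R : realType.

Lemma ln2_pos : 0 < ln 2 :> R.
Proof. by rewrite ln_gt0 // ltr1n. Qed.

Lemma log2_ge1 m : (1 < m)%N -> 1 <= log2 m :> R.
Proof.
move=> m1; rewrite /log2 ler_pdivlMr ?ln2_pos // mul1r ler_ln ?posrE ?ltr0n //.
  by rewrite ler_nat.
exact: ltnW.
Qed.

Lemma up_log_le_log2 m : (1 < m)%N -> (up_log 2 m)%:R <= 2 * log2 m :> R.
Proof.
move=> m1; have l1 := log2_ge1 m1.
have := up_log_gtn (isT : (1 < 2)%N) m1; have := up_log_gt0 2 m; rewrite m1 /=.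
case: (up_log 2 m) => // u _ /= lt_u.
suff : u%:R <= log2 m :> R by rewrite -natr1; lra.
rewrite /log2 ler_pdivlMr ?ln2_pos // mulr_natl -lnXn ?ltr0n // -natrX.
by rewrite ler_ln ?posrE ?ltr0n ?expn_gt0 ?ler_nat ?(ltnW lt_u) // ltnW.
Qed.

Lemma le_powR_root m a c : (0 < c)%N -> m%:R `^ c%:R^-1 <= a%:R :> R ->
  (m <= a ^ c)%N.
Proof.
move=> c0 le_ma; have c_neq0 : c%:R != 0 :> R by rewrite pnatr_eq0 -lt0n.
rewrite -(ler_nat R) natrX -powR_mulrn ?ler0n //.
have E : (m%:R `^ c%:R^-1) `^ c%:R = m%:R :> R.
  by rewrite -powRrM mulVf // powRr1 ?ler0n.
by rewrite -E; apply: ge0_ler_powR; rewrite ?nnegrE ?ler0n ?powR_ge0.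
Qed.

Lemma sqrt_ln_unbounded (x : R) :
  \forall m \near \oo, x <= Num.sqrt (ln (m%:R : R)).
Proof.
near=> m; apply: (@le_trans _ _ `|x|); first exact: ler_norm.
rewrite -(sqrtr_sqr x) ler_wsqrtr // -[leLHS]expRK ler_ln ?posrE ?expR_gt0 //.
  by near: m; apply: nbhs_infty_ger.
by rewrite ltr0n; near: m; exact: nbhs_infty_gt.
Unshelve. all: by end_near. Qed.

(* The witness is [1 / sqrt (ln m)]: then [m `^ eps m = expR (sqrt (ln m))]. *)
Lemma log2_subpolynomial (c : R) : 0 <= c ->
  exists2 eps : nat -> R, eps @ \oo --> (0 : R) &
    \forall m \near \oo, c * log2 m <= m%:R `^ eps m.
Proof.
move=> c0; exists (fun m => (Num.sqrt (ln (m%:R : R)))^-1).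
  apply/cvgr0Pnorm_le => e e0; near=> m.
  rewrite ger0_norm ?invr_ge0 ?sqrtr_ge0 //.
  have le_s : e^-1 <= Num.sqrt (ln (m%:R : R)).
    by near: m; exact: sqrt_ln_unbounded.
  by rewrite -[leRHS]invrK lef_pV2 ?posrE ?invr_gt0 // (lt_le_trans _ le_s) ?invr_gt0.
near=> m.
have : 1 + 6 * (c / ln 2) <= Num.sqrt (ln (m%:R : R)).
  by near: m; exact: sqrt_ln_unbounded.
set s := Num.sqrt _ => s_ge.
have c2 : 0 <= c / ln 2 by rewrite divr_ge0 // ltW ?ln2_pos.
have s1 : 1 <= s by lra.
have m0 : (0 < m)%N by near: m; exact: nbhs_infty_gt.
have m1 : 1 <= m%:R :> R by rewrite ler1n.
have lnE : ln (m%:R : R) = s ^+ 2 by rewrite sqr_sqrtr // ln_ge0.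
rewrite /powR pnatr_eq0 gtn_eqF // lnE expr2 mulKf; last by rewrite gt_eqF; lra.
have s0 : 0 <= s by lra.
(* The cubic term suffices: [expR s >= s ^ 3 / 6], and [s >= 6 c / ln 2] makes this at least
   [c s ^ 2 / ln 2 = c * log2 m]. *)
have := expR_ge1Dxn 2 s0; rewrite (_ : 3`! = 6)%N //.
have -> : c * log2 m = s ^+ 2 * (c / ln 2) by rewrite /log2 lnE mulrCA mulrA.
have s2 : 0 <= s ^+ 2 by apply: sqr_ge0.
have : s ^+ 2 * (6 * (c / ln 2)) <= s ^+ 2 * s by apply: ler_wpM2l => //; lra.
rewrite -exprSr; lra.
Unshelve. all: by end_near. Qed.

End Reals.

Theorem theorem1p2 (R : realType) :
  exists (alpha : nat) (A : algorithm),
  [/\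
   (* A computes an (L, f)-replacement path covering *)
   (forall m (G : wgraph m) (L f : nat), (0 < L)%N -> (0 < f)%N ->
      exists T C, computes A G L f T C /\ is_RPC G L f C),
   (* covering value: a >= m^(1/c) *)
   (forall m (G : wgraph m) (L f T : nat) C, (0 < L)%N -> (0 < f)%N ->
      computes A G L f T C ->
      forall c : nat, (0 < c)%N ->
      m%:R `^ c%:R^-1 <= (maxn L f)%:R :> R ->
      (CV C <= (alpha * c * L * f) ^ (minn L f).+1)%N) /\
   (* covering value: a = m^o(1) and b = Omega(log m) *)
   (forall L f : nat -> nat,
      (forall m, (0 < L m)%N) -> (forall m, (0 < f m)%N) ->
      subpolynomial_regime R L f ->
      \forall m \near \oo, forall (G : wgraph m) T C,
        computes A G (L m) (f m) T C ->
        (CV C)%:R <=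
          (alpha * L m * f m)%:R ^+ (minn (L m) (f m)).+2 * log2 m :> R),
   (* covering value: a <= log m *)
   (forall m (G : wgraph m) (L f T : nat) C, (0 < L)%N -> (0 < f)%N ->
      computes A G L f T C ->
      (maxn L f)%:R <= log2 m :> R ->
      (CV C)%:R <= (alpha * L * f)%:R ^+ (minn L f).+2 * log2 m :> R) /\
   (* covering value: otherwise *)
   (forall L f : nat -> nat,
      (forall m, (0 < L m)%N) -> (forall m, (0 < f m)%N) ->
      ~ polynomial_regime R L f -> ~ subpolynomial_regime R L f ->
      forall m (G : wgraph m) T C, (1 < m)%N ->
        computes A G (L m) (f m) T C ->
        ~ ((maxn (L m) (f m))%:R <= log2 m :> R) ->
        (CV C)%:R <=
          ((alpha * L m * f m)%:R * log2 m) ^+ (minn (L m) (f m)).+1 :> R),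
   (* running time: a = m^o(1) and b = Omega(log m) *)
   (forall L f : nat -> nat,
      (forall m, (0 < L m)%N) -> (forall m, (0 < f m)%N) ->
      subpolynomial_regime R L f ->
      exists2 eps : nat -> R, eps @ \oo --> (0 : R) &
      \forall m \near \oo, forall (G : wgraph m) T C,
        computes A G (L m) (f m) T C ->
        T%:R <= m%:R `^ (1 + eps m) * (CV C)%:R :> R)
   & (* running time: otherwise *)
   exists K : nat, forall L f : nat -> nat,
      (forall m, (0 < L m)%N) -> (forall m, (0 < f m)%N) ->
      ~ subpolynomial_regime R L f ->
      forall m (G : wgraph m) T C, (1 < m)%N ->
        computes A G (L m) (f m) T C ->
        T%:R <= K%:R * m%:R * log2 m ^+ K * (CV C)%:R :> R].

Proof.
(* The constants become variables, so no tactic computes with [4 ^ 6]. *)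
move: CV_const time_const rpc_algorithm_spec => c0 K0 rpc_spec.
(* Twice the [240 c0] of the logarithmic bound: the 2 pays for [up_log 2 m <= 2 * log2 m]. *)
pose alpha := (480 * c0)%N; exists alpha, rpc_algorithm.
(* Determinism: whatever [T] and [C] a run yields are those of the specification. *)
have spec m (G : wgraph m) L f T C : (0 < L)%N -> (0 < f)%N ->
    computes rpc_algorithm G L f T C ->
    exists k, [/\ forall c, (0 < c)%N -> (m <= maxn L f ^ c)%N -> (k <= c)%N,
    (CV C <= (8 * c0 * k * L * f) ^ (minn L f).+1)%N
  & [/\ (1 < m)%N -> (CV C <= (240 * c0 * L * f) ^ (minn L f).+2 * up_log 2 m)%N,
        (1 < m)%N -> (k <= up_log 2 m)%N
      & (0 < m)%N -> (T <= K0 * m * k * CV C)%N]].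
  move=> L0 f0 comp; have [T' [C' [k [comp' _ H1 H2 H3]]]] := rpc_spec _ G _ _ L0 f0.
  by have [-> ->] := computes_inj comp comp'; exists k.
have CV_log m (G : wgraph m) L f T C : (0 < L)%N -> (0 < f)%N -> (1 < m)%N ->
    computes rpc_algorithm G L f T C ->
    (CV C)%:R <= (alpha * L * f)%:R ^+ (minn L f).+2 * log2 m :> R.
  move=> L0 f0 m1 /(spec _ _ _ _ _ _ L0 f0)[k [_ _ [H _ _]]].
  apply: le_trans (_ : ((240 * c0 * L * f) ^ (minn L f).+2 * up_log 2 m)%:R <= _).
    by rewrite ler_nat H.
  have -> : (alpha * L * f = 2 * (240 * c0 * L * f))%N.
    by rewrite /alpha; lia.
  set N := (240 * c0 * L * f)%N; set e := (minn L f).+2.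
  have -> : (2 * N)%:R ^+ e * log2 m = N%:R ^+ e * (2 ^+ e * log2 m) :> R.
    by move: e => e; rewrite natrM exprMn -mulrA mulrCA.
  rewrite natrM natrX; apply: ler_wpM2l; first by rewrite exprn_ge0 ?ler0n.
  apply: le_trans (up_log_le_log2 R m1) _.
  apply: ler_wpM2r; first by apply: le_trans (log2_ge1 R m1).
  by rewrite ler_eXnr // ler1n.
have time m (G : wgraph m) L f T C : (0 < L)%N -> (0 < f)%N -> (1 < m)%N ->
    computes rpc_algorithm G L f T C ->
    T%:R <= (2 * K0)%:R * log2 m * m%:R * (CV C)%:R :> R.
  move=> L0 f0 m1 /(spec _ _ _ _ _ _ L0 f0)[k [_ _ [_ le_k le_T]]].
  apply: le_trans (_ : (K0 * m * k * CV C)%:R <= _).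
    by rewrite ler_nat le_T // ltnW.
  rewrite !natrM; apply: ler_wpM2r; first exact: ler0n.
  rewrite mulrAC; apply: ler_wpM2r; first exact: ler0n.
  rewrite [2 * _]mulrC -mulrA; apply: ler_wpM2l; first exact: ler0n.
  by apply: le_trans (up_log_le_log2 R m1); rewrite ler_nat le_k.
split.
- move=> m G L f L0 f0.
  by have [T [C [k [comp rpc _ _ _]]]] := rpc_spec _ G _ _ L0 f0; exists T, C.
- split.
    move=> m G L f T C L0 f0 /(spec _ _ _ _ _ _ L0 f0)[k [le_k H _]] c c_gt0 le_mc.
    apply: leq_trans H _; rewrite leq_exp2r // /alpha !leq_mul //.
    by apply: le_k => //; apply: le_powR_root le_mc.
  move=> L f L0 f0 _; near=> m => G T C; apply: CV_log => //.
  by near: m; exact: nbhs_infty_gt.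
- split.
    move=> m G L f T C L0 f0 comp le_a; apply: CV_log comp => //.
    (* For [m <= 1] the logarithm is at most 0, while the larger parameter is at least 1. *)
    rewrite ltnNge; apply/negP => m1; move: le_a; rewrite leNgt => /negP; apply.
    apply: (@le_lt_trans _ _ 0); last by rewrite ltr0n leq_max L0.
    by rewrite /log2 pmulr_lle0 ?invr_gt0 ?ln2_pos // ln_le0 // lern1.
  move=> L f L0 f0 _ _ m G T C m1 /(spec _ _ _ _ _ _ (L0 m) (f0 m))[k [_ H [_ le_k _]]] _.
  apply: le_trans (_ : ((8 * c0 * k * L m * f m) ^ (minn (L m) (f m)).+1)%:R <= _).
    by rewrite ler_nat.
  have log_ge0 : 0 <= log2 m :> R by apply: le_trans (log2_ge1 R m1).
  rewrite natrX; apply: lerXn2r; rewrite ?nnegrE ?ler0n //.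
    by apply: mulr_ge0 => //; exact: ler0n.
  have le_kR : k%:R <= 2 * log2 m :> R.
    by apply: le_trans (up_log_le_log2 R m1); rewrite ler_nat le_k.
  have -> : (8 * c0 * k * L m * f m = 8 * c0 * L m * f m * k)%N.
    by lia.
  rewrite natrM; apply: le_trans (ler_wpM2l (ler0n _ _) le_kR) _.
  rewrite mulrA -natrM; apply: ler_wpM2r => //.
  by rewrite ler_nat /alpha; lia.
- move=> L f L0 f0 _.
  have [eps eps0 le_eps] := log2_subpolynomial (ler0n R (2 * K0)).
  exists eps => //; near=> m => G T C comp.
  have m1 : (1 < m)%N by near: m; exact: nbhs_infty_gt.
  apply: le_trans (time _ _ _ _ _ _ (L0 m) (f0 m) m1 comp) _.
  apply: ler_wpM2r; first exact: ler0n.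
  rewrite powRD; last by rewrite pnatr_eq0 -lt0n ltnW ?implybT.
  rewrite powRr1 ?ler0n // [leRHS]mulrC; apply: ler_wpM2r; first exact: ler0n.
  by near: m.
(* One number serves as factor and as exponent; the successor makes the exponent positive. *)
- exists (2 * K0).+1 => L f L0 f0 _ m G T C m1 comp.
  have l1 := log2_ge1 R m1; have l0 : 0 <= log2 m :> R := le_trans ler01 l1.
  apply: le_trans (time _ _ _ _ _ _ (L0 m) (f0 m) m1 comp) _.
  apply: ler_wpM2r; first exact: ler0n.
  rewrite mulrAC; apply: ler_pM => //.
    by apply: ler_wpM2r; rewrite ?ler0n // ler_nat.
  by rewrite ler_eXnr.
Unshelve. all: by end_near.
Qed.
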